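(* Let $\Omega\subset\mathbb{R}^N$ be a bounded open set and let $p,q,p_n,q_n\colon\Omega\to[1,\infty)$ ($n\in\mathbb{N}$) be bounded measurable exponents such that $p_n\to p$ and $q_n\to q$ in $L^\infty(\Omega)$. Assume, moreover, that $p_n\ge p$ and $q_n\le q$ for all $n$. Then $$ S(p_n(\cdot),q_n(\cdot),\Omega)\to S(p(\cdot),q(\cdot),\Omega)\qquad\text{as } n\to\infty. $$
   Context: For a bounded measurable exponent $p\colon\Omega\to[1,\infty)$, $L^{p(x)}(\Omega)$ is the space of $u\in L^1_{\mathrm{loc}}(\Omega)$ with $\int_\Omega|u|^{p(x)}\,dx<\infty$, with norm $\|u\|_{L^{p(x)}(\Omega)}=\inf\{\lambda>0\colon\int_\Omega|u(x)/\lambda|^{p(x)}dx\le1\}$; $W^{1,p(x)}(\Omega)$ is the space of $u\in W^{1,1}_{\mathrm{loc}}(\Omega)$ with $u,|\nabla u|\in L^{p(x)}(\Omega)$, with norm $\|u\|_{L^{p(x)}(\Omega)}+\|\nabla u\|_{L^{p(x)}(\Omega)}$; $W^{1,p(x)}_0(\Omega)$ is the closure of $C_c^\infty(\Omega)$ in it. Sobolev constant: $S(p(\cdot),q(\cdot),\Omega)=\inf\big\{\|\nabla v\|_{L^{p(x)}(\Omega)}/\|v\|_{L^{q(x)}(\Omega)}\colon v\in W^{1,p(x)}_0(\Omega),\ v\ne0\big\}$ (the quotient being $0$ if $\|v\|_{L^{q(x)}(\Omega)}=\infty$). *)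

(* Defs.v *)
From HB Require Import structures.
From mathcomp Require Import all_boot all_order all_algebra.
From mathcomp Require Import all_classical all_reals all_analysis.

Set Implicit Arguments.
Unset Strict Implicit.
Unset Printing Implicit Defensive.

Import Order.TTheory GRing.Theory Num.Theory.
Import numFieldNormedType.Exports.

Local Open Scope classical_set_scope.
Local Open Scope ring_scope.

(* Lebesgue outer measure on R^(N+1) by countable covers with half-open boxes;
   the dimension is written [N.+1] so that it is positive. *)
Section lebesgue_rV.
Local Open Scope ereal_scope.
Context {R : realType} {N : nat}.
Notation V := 'rV[R]_N.+1.
Implicit Types (c : V * V) (A : set V).

Definition box c : set V :=
  [set x | forall i, x ord0 i \in `]c.1 ord0 i, c.2 ord0 i]].

(* [Num.max 0] gives volume [0] to the boxes that are empty *)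
Definition box_volume c : \bar R :=
  (\prod_i Num.max 0 (c.2 ord0 i - c.1 ord0 i))%R%:E.

Definition lebesgue_rV_outer A : \bar R :=
  ereal_inf [set \sum_(k <oo) box_volume (c k) |
             c in [set c : nat -> V * V | A `<=` \bigcup_k box (c k)]].

Lemma box_volume_ge0 c : 0 <= box_volume c.
Proof. by rewrite lee_fin prodr_ge0// => i _; rewrite le_max lexx. Qed.

Lemma lebesgue_rV_outer_ge0 A : 0 <= lebesgue_rV_outer A.
Proof.
apply: le_ereal_inf_tmp => _ [c _ <-].
by apply: nneseries_ge0 => k _ _; exact: box_volume_ge0.
Qed.

Lemma lebesgue_rV_outer0 : lebesgue_rV_outer set0 = 0.
Proof.
apply/eqP; rewrite eq_le lebesgue_rV_outer_ge0 andbT.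
apply: ereal_inf_lbound; exists (fun=> (0%R, 0%R)); first exact: sub0set.
apply: eseries0 => k _ _.
by rewrite /box_volume /= big_ord_recl !mxE subrr maxxx mul0r.
Qed.

Lemma le_lebesgue_rV_outer :
  {homo lebesgue_rV_outer : A B / A `<=` B >-> A <= B}.
Proof.
move=> A B AB; apply: ereal_inf_le_tmp => _ [c Bc <-].
by exists c => //; exact: subset_trans Bc.
Qed.

Lemma lebesgue_rV_outer_sigma_subadditive : sigma_subadditive lebesgue_rV_outer.
Proof.
move=> A; have [[i ioo]|] := pselect (exists i, lebesgue_rV_outer (A i) = +oo).
  rewrite (eseries_pinfty _ _ ioo) ?leey// => n _.
  by rewrite -ltNye (lt_le_trans _ (lebesgue_rV_outer_ge0 _)).
rewrite -forallNE => Aoo.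
suff add2e (e : {posnum R}) : lebesgue_rV_outer (\bigcup_n A n) <=
    \sum_(i <oo) lebesgue_rV_outer (A i) + e%:num%:E.
  by apply/lee_addgt0Pr => _/posnumP[].
rewrite (le_trans _ (epsilon_trick _ _ _))//.
pose P n (B : nat -> V * V) := A n `<=` \bigcup_k box (B k) /\
  \sum_(k <oo) box_volume (B k) <=
    lebesgue_rV_outer (A n) + (e%:num / (2 ^ n.+1)%:R)%:E.
have [G PG] : {G : nat -> nat -> V * V & forall n, P n (G n)}.
  apply: (@choice _ _ P) => n; rewrite /P /lebesgue_rV_outer.
  set S := (X in ereal_inf X); move infS : (ereal_inf S) => iS.
  case: iS infS => [r Sr|Soo|Soo].
  - have en1 : (0 < e%:num / (2 ^ n.+1)%:R)%R by [].
    have /(lb_ereal_inf_adherent en1) : ereal_inf S \is a fin_num by rewrite Sr.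
    move=> [x [B AnB muBx] xS].
    by exists B; split => //; rewrite muBx -Sr; exact/ltW.
  - by have := Aoo n; rewrite /lebesgue_rV_outer Soo.
  - by have := lebesgue_rV_outer_ge0 (A n); rewrite /lebesgue_rV_outer Soo.
have vol_ge0 x : 0 <= (box_volume \o uncurry G) x by exact: box_volume_ge0.
apply: (@le_trans _ _ (\esum_(i in setT) (box_volume \o uncurry G) i)).
  apply: ereal_inf_lbound => /=.
  have /card_esym/ppcard_eqP[f] := card_nat2.
  exists (uncurry G \o f).
    move=> t [i _ /(PG i).1[j _ Bijt]]; exists (f^-1%FUN (i, j)) => //=.
    by rewrite invK ?inE.
  rewrite -(esum_pred_image (box_volume \o uncurry G) _ xpredT) ?[fun=> _]set_true//.
  by rewrite image_eq.
have -> : \esum_(i in setT) (box_volume \o uncurry G) i =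
    \sum_(i <oo) \sum_(j <oo) box_volume (G i j).
  pose J : nat -> set (nat * nat) := fun i => [set (i, j) | j in setT].
  have -> : setT = \bigcup_k J k.
    by rewrite predeqE => -[a b]; split => // _; exists a => //; exists b.
  rewrite esum_bigcupT /=; last 2 first.
    - apply/trivIsetP => i j _ _ ij.
      rewrite predeqE => -[n m] /=; split => //= -[] [_] _ [<-{n} _].
      by move=> [m' _] [] /esym/eqP; rewrite (negbTE ij).
    - by move=> x; exact: vol_ge0.
  rewrite -(image_id [set: nat]) -fun_true esum_pred_image//; last first.
    by move=> n _; apply: esum_ge0 => x _; exact: vol_ge0.
  apply: eq_eseriesr => /= j _.
  rewrite -(esum_pred_image (box_volume \o uncurry G) (pair j) predT)//=.
  - by congr esum; rewrite predeqE => -[a b]; split; move=> [i _ <-]; exists i.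
  - by move=> k _; exact: box_volume_ge0.
  - by move=> ? ? _ _; exact: (@can_inj _ _ _ snd).
apply: lee_nneseries => [n _ _|n _]; last exact: (PG n).2.
  by apply: nneseries_ge0 => k _ _; exact: box_volume_ge0.
by move=> n; exact: lebesgue_rV_outer_ge0.
Qed.

HB.instance Definition _ := isOuterMeasure.Build R V lebesgue_rV_outer
  lebesgue_rV_outer0 lebesgue_rV_outer_ge0 le_lebesgue_rV_outer
  lebesgue_rV_outer_sigma_subadditive.

End lebesgue_rV.

(* ['rV_N.+1] carries the (complete) sigma-algebra of Lebesgue measurable
   sets, i.e. the Caratheodory measurable sets of the outer measure. *)
HB.instance Definition _ (R : realType) (N : nat) := Measurable.copy
  'rV[R]_N.+1 (caratheodory_type (@lebesgue_rV_outer R N)).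

Definition lebesgue_rV {R : realType} {N : nat} : set 'rV[R]_N.+1 -> \bar R :=
  lebesgue_rV_outer.

HB.instance Definition _ (R : realType) (N : nat) := isMeasure.Build _ _ R
  (@lebesgue_rV R N)
  (@caratheodory_measure0 _ _ (@lebesgue_rV_outer R N))
  (@caratheodory_measure_ge0 _ _ (@lebesgue_rV_outer R N))
  (@caratheodory_measure_sigma_additive _ _ (@lebesgue_rV_outer R N)).

Section smooth_functions.
Context {R : realType} {N : nat}.
Notation V := 'rV[R]_N.+1.

Definition partial (i : 'I_N.+1) (f : V -> R) : V -> R :=
  fun x => 'D_(delta_mx ord0 i) f x.

Definition gradient (f : V -> R) : V -> V := fun x => \row_i partial i f x.

Fixpoint Ck (k : nat) (f : V -> R) : Prop :=
  continuous f /\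
  (if k is k'.+1 then
     forall i, (forall x, derivable f x (delta_mx ord0 i)) /\ Ck k' (partial i f)
   else True).

Definition smooth f := forall k, Ck k f.

(* test functions on [Omega] are extended by [0] to the whole space *)
Definition Cc_smooth (Omega : set V) (f : V -> R) : Prop :=
  let supp := closure [set x | f x != 0] in
  [/\ smooth f, compact supp & supp `<=` Omega].

End smooth_functions.

(* Functions on [Omega] are total functions on the whole space; only their
   values on [Omega] matter. *)
Section variable_exponent_spaces.
Context {R : realType} {N : nat}.
Notation V := 'rV[R]_N.+1.
Local Notation mu := (@lebesgue_rV R N).
Implicit Types (Omega : set V) (p q u v : V -> R) (g : V -> V).

Definition bounded_exponent Omega p : Prop :=
  [/\ measurable_fun Omega p,
      forall x, Omega x -> 1 <= p x &
      exists M, forall x, Omega x -> p x <= M].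

Definition L1loc Omega u : Prop :=
  measurable_fun Omega u /\
  forall K, K `<=` Omega -> compact K ->
    (\int[mu]_(x in K) `|u x|%:E < +oo)%E.

Definition modular Omega p u : \bar R :=
  (\int[mu]_(x in Omega) (`|u x| `^ p x)%:E)%E.

Definition in_Lpx Omega p u : Prop :=
  L1loc Omega u /\ (modular Omega p u < +oo)%E.

(* [+oo] if there is no admissible [l] *)
Definition Lpx_norm Omega p u : \bar R :=
  ereal_inf [set l%:E | l in
    [set l : R | 0 < l /\ (modular Omega p (fun x => (u x / l)%R) <= 1)%E]].

(* the library norm [`| _ |] on row vectors is the sup norm *)
Definition euclid_norm (x : V) : R := Num.sqrt (\sum_i x ord0 i ^+ 2).

(* [u] is in [W^{1,1}_loc] with weak gradient [g] *)
Definition weak_gradient Omega u g : Prop :=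
  [/\ L1loc Omega u,
      forall i, L1loc Omega (fun x => g x ord0 i) &
      forall phi, Cc_smooth Omega phi -> forall i,
        (\int[mu]_(x in Omega) (u x * partial i phi x)%:E =
         - \int[mu]_(x in Omega) (g x ord0 i * phi x)%:E)%E].

(* An element of a Sobolev space is represented by a function together with
   (a version of) its weak gradient. *)
Definition in_W1px Omega p u g : Prop :=
  [/\ weak_gradient Omega u g, in_Lpx Omega p u &
      in_Lpx Omega p (euclid_norm \o g)].

Definition W1px_norm Omega p u g : \bar R :=
  (Lpx_norm Omega p u + Lpx_norm Omega p (euclid_norm \o g))%E.

Definition in_W1px0 Omega p u g : Prop :=
  in_W1px Omega p u g /\
  forall e : R, 0 < e -> exists2 phi, Cc_smooth Omega phi &
    (W1px_norm Omega p (u \- phi)%R (g \- gradient phi)%R < e%:E)%E.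

Definition sobolev_quotient Omega p q v g : \bar R :=
  if Lpx_norm Omega q v == +oo%E then 0%E
  else (Lpx_norm Omega p (euclid_norm \o g) / Lpx_norm Omega q v)%E.

Definition sobolev_constant Omega p q : \bar R :=
  ereal_inf [set s | exists v g,
    [/\ in_W1px0 Omega p v g,
        ~ {ae mu, forall x, Omega x -> v x = 0} &
        s = sobolev_quotient Omega p q v g]].

Definition Linfty_norm Omega u : \bar R := Lnorm mu +oo%E (EFin \o (u \_ Omega)).

End variable_exponent_spaces.

(* Main.v *)
Require Import Defs.
From HB Require Import structures.
From mathcomp Require Import all_boot all_order all_algebra.
From mathcomp Require Import all_classical all_reals all_analysis.
From mathcomp Require Import measurable_realfun ess_sup_inf.
From mathcomp Require Import ring lra.

(* Let [m] be the measure of [Omega].  If [p <= q <= p + e], then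
   [t ^ p <= t ^ q + e] for [t >= 0], hence [|u|_p <= (1 + e * m) |u|_q]; applied
   to [p <= p'] and [q' <= q] this gives [S(p, q) <= (1 + e * m)^2 S(p', q')],
   i.e. the lower bound on the limit.  For the upper bound, the infimum
   [S(p, q)] may be computed on test functions, because [|.|_q] is lower
   semicontinuous under convergence in [L^p] (Fatou); for a fixed test function,
   which is bounded with a bounded gradient, [t ^ q <= T ^ e * t ^ p] on [0, T]
   makes its quotient upper semicontinuous in the exponents.  Test functions lie
   in every [W^{1,p}_0] by integration by parts, which follows from translation
   invariance of the measure and dominated convergence of difference quotients. *)

Import Order.TTheory GRing.Theory Num.Theory.
Import numFieldNormedType.Exports.

Set Implicit Arguments.
Unset Strict Implicit.
Unset Printing Implicit Defensive.

Local Open Scope classical_set_scope.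
Local Open Scope ring_scope.

(** * Lebesgue measure on row vectors *)

(** The passage from modulars to norms rests on all exponents being at least 1: dividing [u] by a
    further factor [c >= 1] divides its modular by at least [c]. A modular bounded by [1 + e * m]
    therefore costs only that factor in the norm, uniformly in the function, so the lower estimate
    covers all competitors at once. The square arises because the factor is paid once for the
    gradient and once for the denominator. Test functions do, but they approximate [v] only in
    [W^{1,p}], which need not control the [q]-norm, and [|v|_q] may be infinite. What saves the
    argument is that only a lower bound on the denominator is required, and it survives once the
    approximation is turned into convergence almost everywhere. *)

Section lebesgue_measure_rV.
Context {R : realType} {N : nat}.
Notation V := 'rV[R]_N.+1.
Local Notation mu := (@lebesgue_rV R N).
Implicit Types (c : V * V) (A : set V) (i : 'I_N.+1) (a b : R).

Let set_coord (x : V) i a : V := \row_j (if j == i then a else x ord0 j).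

(** Cutting along [x_i = a] affects only the [i]-th factor of the product. Truncation at [0] keeps
    the one-dimensional identity true for an empty box and for one missed by the hyperplane. *)
Lemma box_volume_split c i a :
  box_volume c =
  (box_volume (c.1, set_coord c.2 i (Num.min (c.2 ord0 i) a)) +
   box_volume (set_coord c.1 i (Num.max (c.1 ord0 i) a), c.2))%E.
Proof.
rewrite /box_volume -EFinD; congr EFin.
rewrite (bigD1 i)//= [X in _ = X + _](bigD1 i)//= [X in _ = _ + X](bigD1 i)//=.
rewrite !mxE eqxx.
rewrite [X in _ = _ * X + _](eq_bigr
  (fun j => Num.max 0 (c.2 ord0 j - c.1 ord0 j))); last first.
  by move=> j ji; rewrite !mxE (negbTE ji).
rewrite [X in _ = _ + _ * X](eq_bigr
  (fun j => Num.max 0 (c.2 ord0 j - c.1 ord0 j))); last first.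
  by move=> j ji; rewrite !mxE (negbTE ji).
rewrite -mulrDl; congr (_ * _).
case: (ltP (c.2 ord0 i) a) => ?; case: (ltP (c.1 ord0 i) a) => ?;
  rewrite ?[Num.min (c.2 _ _) _]minElt ?[Num.max (c.1 _ _) _]maxElt;
  do 2?case: ltP => ? //;
  by rewrite /Num.max; do 3?case: ltP => ? //; lra.
Qed.

(** Caratheodory's inequality holds box by box: the two halves of a cover of [X] cover the two parts
    of [X], and no volume is lost. Boxes closed on the right are cut exactly by [x_i <= a]. *)
Lemma measurable_halfspace i a : measurable [set x : V | x ord0 i <= a].
Proof.
apply: le_caratheodory_measurable => X.
apply: le_ereal_inf_tmp => _ [c Xc <-].
rewrite (eq_eseriesr (fun k _ => box_volume_split (c k) i a)).
rewrite nneseriesD; [|by move=> *; exact: box_volume_ge0..].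
apply: leeD.
  apply: ereal_inf_lbound.
  exists (fun k => ((c k).1, set_coord (c k).2 i (Num.min ((c k).2 ord0 i) a))) => //.
  move=> x [/Xc[k _ ckx] xa]; exists k => // j /=.
  rewrite mxE; have := ckx j; rewrite !in_itv/=; case: eqVneq => // -> /andP[-> xc].
  by rewrite le_min xc.
apply: ereal_inf_lbound.
exists (fun k => (set_coord (c k).1 i (Num.max ((c k).1 ord0 i) a), (c k).2)) => //.
move=> x [/Xc[k _ ckx] /negP]; rewrite -ltNge => xa; exists k => // j /=.
rewrite mxE; have := ckx j; rewrite !in_itv/=; case: eqVneq => // -> /andP[xc ->].
by rewrite gt_max xc xa.
Qed.

Lemma measurable_coord i : measurable_fun [set: V] (fun x : V => x ord0 i).
Proof.
apply: (measurability _ (RGenOInfty.measurableE R)) => /= _ [_ [a ->] <-].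
rewrite setTI (_ : _ @^-1` _ = ~` [set x : V | x ord0 i <= a]).
  by apply: measurableC; exact: measurable_halfspace.
by apply/seteqP; split => x /=; rewrite in_itv/= andbT ltNge => /negP.
Qed.

(** An open set is the countable union of the closed sup-norm cubes with rational centre and radius
    [1 / (n + 1)] that it contains; each cube is a finite intersection of coordinate slabs. *)
Lemma open_measurable_rV A : open A -> measurable A.
Proof.
move=> oA.
pose Q (q : 'rV[rat]_N.+1) (n : nat) : set V :=
  [set x | forall i, `|ratr (q ord0 i) - x ord0 i| <= n.+1%:R^-1].
have mQ q n : measurable (Q q n).
  rewrite (_ : Q q n = \bigcap_(i in [set: 'I_N.+1])
      ((fun x : V => x ord0 i) @^-1`
       `[ratr (q ord0 i) - n.+1%:R^-1, ratr (q ord0 i) + n.+1%:R^-1])).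
    apply: fin_bigcap_measurable => //.
    by move=> i _; rewrite -[X in measurable X]setTI; exact: measurable_coord.
  apply/seteqP; split => x /=.
    by move=> Qx i _ /=; have := Qx i; rewrite in_itv/= ler_distlC.
  by move=> Qx i; have := Qx i I; rewrite /= in_itv/= ler_distlC.
pose F (k : nat) : set V := if unpickle k is Some qn then
  (if `[< Q qn.1 qn.2 `<=` A >] then Q qn.1 qn.2 else set0) else set0.
suff -> : A = \bigcup_k F k.
  apply: bigcupT_measurable => k; rewrite /F; case: unpickle => [qn|]//.
  by case: ifP.
apply/seteqP; split=> [x Ax|x [k _]]; last first.
  by rewrite /F; case: unpickle => // qn; case: asboolP => // + Qx; exact.
have /nbhs_ballP[e /= e0 eA] : nbhs x A by exact: open_nbhs_nbhs.
(* The radius is below [e / 2] because points of the cube are compared with [x] through its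
   centre. *)
have [n ne] : exists n, (n.+1%:R^-1 : R) < e / 2.
  have /ltr_add_invr[n] : 0 < e / 2 by rewrite divr_gt0.
  by rewrite add0r; exists n.
have /choice[q xq] : forall i, exists q : rat, `|ratr q - x ord0 i| < n.+1%:R^-1.
  move=> i; have /rat_in_itvoo[q] : x ord0 i - n.+1%:R^-1 < x ord0 i + n.+1%:R^-1.
    by rewrite ltrBlDr -addrA ltrDl addr_gt0 ?invr_gt0.
  by rewrite in_itv/= -ltr_distl; exists q.
exists (pickle (\row_i q i, n)) => //; rewrite /F pickleK/=.
case: asboolP => [_|].
  by move=> i; rewrite mxE; exact: ltW.
case=> y Qy; apply: eA; split=> // i j; rewrite ord1.
have := Qy j; rewrite mxE => yq; have xqj := xq j.
rewrite /ball/= (_ : _ - _ =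
  (ratr (q j) - y ord0 j) - (ratr (q j) - x ord0 j)); last by lra.
rewrite (le_lt_trans (ler_normB _ _))// [ltRHS]splitr.
by rewrite ltrD// ?(le_lt_trans yq)// (lt_trans xqj).
Qed.

Lemma continuous_measurable_rV (f : V -> R) :
  continuous f -> measurable_fun [set: V] f.
Proof.
move=> cf; apply: (measurability _ (RGenOpens.measurableE R)) => _ [_ [a [b ->]] <-].
rewrite setTI; apply: open_measurable_rV; apply: open_comp => //.
Qed.

Lemma lebesgue_rV_outer_shift (h : V) A :
  (lebesgue_rV_outer ((fun x => (x + h)%R) @^-1` A) <= lebesgue_rV_outer A)%E.
Proof.
apply: le_ereal_inf_tmp => _ [c Ac <-]; apply: ereal_inf_lbound.
exists (fun k => ((c k).1 - h, (c k).2 - h)).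
  move=> x /Ac[k _ ckx]; exists k => // i; have := ckx i; rewrite !in_itv/= !mxE.
  by rewrite ltrBlDr lerBrDr.
apply: eq_eseriesr => k _; rewrite /box_volume/=; congr EFin; apply: eq_bigr => i _.
by rewrite !mxE; congr Num.max; lra.
Qed.

Lemma lebesgue_rV_shift (h : V) A : mu ((fun x => x + h) @^-1` A) = mu A.
Proof.
apply/eqP; rewrite eq_le; apply/andP; split; first exact: lebesgue_rV_outer_shift.
rewrite (_ : A = (fun x => x - h) @^-1` ((fun x => x + h) @^-1` A)).
  rewrite [in leRHS](_ : _ @^-1` _ = (fun x => x + h) @^-1` A).
    exact: lebesgue_rV_outer_shift.
  by apply/seteqP; split => x /=; rewrite addrK.
by apply/seteqP; split => x /=; rewrite subrK.
Qed.

(** The sigma-algebra consists of all Caratheodory sets, so checking generators is not enough. By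
    invariance of the outer measure, the condition for the preimage of [A] with test set [X] is the
    condition for [A] with [X] translated by [h]. *)
Lemma measurable_shift (h : V) : measurable_fun [set: V] (fun x : V => x + h).
Proof.
move=> _ A mA; rewrite setTI.
change (caratheodory_measurable (@lebesgue_rV_outer R N) A) in mA.
change (caratheodory_measurable (@lebesgue_rV_outer R N) (+%R^~ h @^-1` A)).
move=> X.
have sh (B : set V) : lebesgue_rV_outer B = lebesgue_rV_outer ((fun x => x - h) @^-1` B).
  by rewrite -[RHS](lebesgue_rV_shift h); congr lebesgue_rV_outer;
    apply/seteqP; split => x /=; rewrite addrK.
rewrite sh [X in _ = (X + _)%E]sh [X in _ = (_ + X)%E]sh (mA _).
congr (_ + _)%E; apply: (f_equal (@lebesgue_rV_outer R N));
  apply/seteqP; split => x /=; rewrite /setI/= /setC/= subrK //.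
Qed.

Lemma normr_coord_le (x : V) i : `|x ord0 i| <= `|x|.
Proof. by rewrite [leRHS]/Num.norm/= mx_normrE (le_bigmax _ _ (ord0, i)). Qed.

Lemma lebesgue_rV_bounded A : bounded_set A -> (mu A < +oo)%E.
Proof.
move=> [M [Mr MA]].
have AM x : A x -> `|x| <= M + 1 by apply: MA; rewrite ltrDl.
(* The extra unit leaves room at the open left faces of the box. *)
pose c : V * V := (const_mx (- (M + 2)), const_mx (M + 2)).
apply: (@le_lt_trans _ _ (box_volume c)); last by rewrite ltry.
apply: ereal_inf_lbound.
exists (fun k => if k == 0 then c else (0, 0)).
  move=> x Ax; exists 0%N => // i; rewrite /= !mxE in_itv/=.
  have := le_trans (normr_coord_le x i) (AM _ Ax).
  by rewrite ler_norml => /andP[] *; apply/andP; split; lra.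
rewrite nneseries_recl//; last by move=> k _; exact: box_volume_ge0.
rewrite eseries0 ?adde0// => k /=; case: k => // k _ _.
by rewrite /box_volume /= big_ord_recl !mxE subrr maxxx mul0r.
Qed.

End lebesgue_measure_rV.

(** * Variable exponent norms on a measure space *)

Section powR_extra.
Context {R : realType}.
Implicit Types (a b c e s t l T : R).

(* On [0, 1], [t ^ a - t ^ b <= (b - a) * t * ln (1 / t)] and
   [t * ln (1 / t) <= 1]. *)
Lemma powR_le_addr t a b e : 0 <= t -> 1 <= a -> a <= b -> b <= a + e ->
  t `^ a <= t `^ b + e.
Proof.
move=> t0 a1 ab be; have e0 : 0 <= e by lra.
have [t1|t1] := leP 1 t; first by rewrite (le_trans (ler_powR t1 ab))// lerDl.
move: t0; rewrite le_eqVlt => /predU1P[<-|t0].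
  by rewrite powR0 ?gt_eqF ?(lt_le_trans _ a1)// addr_ge0 ?powR_ge0.
rewrite -lerBlDl (_ : b = a + (b - a)); last by lra.
rewrite powRD; last by rewrite (gt_eqF t0) implybT.
have ta : t `^ a <= t by rewrite ge1r_powR// t0 ltW.
have ta0 : 0 <= t `^ a := powR_ge0 _ _.
have tba : 1 + (b - a) * ln t <= t `^ (b - a).
  by rewrite [leRHS]/powR gt_eqF// expR_ge1Dx.
have lnt : - ln t <= t^-1 - 1.
  rewrite -lnV ?posrE//.
  have := @le_ln1Dx R (t^-1 - 1); rewrite subrKC; apply.
  by rewrite ltrBrDl subrr invr_gt0.
have lnt0 : 0 <= - ln t by rewrite oppr_ge0 ln_le0// ltW.
have tlnt : t `^ a * - ln t <= 1.
  rewrite (le_trans (ler_wpM2r lnt0 ta))// (le_trans (ler_wpM2l (ltW t0) lnt))//.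
  by rewrite mulrBr mulfV ?gt_eqF// mulr1; lra.
have : t `^ a * (1 - t `^ (b - a)) <= t `^ a * ((b - a) * - ln t).
  by apply: ler_wpM2l => //; lra.
have : (b - a) * (t `^ a * - ln t) <= (b - a) * 1 by rewrite ler_wpM2l ?subr_ge0.
by lra.
Qed.

(** Below [1] a larger exponent only helps; above [1] the excess [t ^ (b - a)] is at most [T ^ e],
    which tends to [1] with [e]. *)
Lemma powR_le_mulr t a b e T : 0 <= t <= T -> 1 <= T -> 1 <= a -> a <= b ->
  b <= a + e -> t `^ b <= T `^ e * t `^ a.
Proof.
move=> /andP[t0 tT] T1 a1 ab be; have e0 : 0 <= e by lra.
have Te : 1 <= T `^ e by rewrite -(@powRr0 _ T) ler_powR.
have [t1|t1] := leP t 1.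
  move: t0; rewrite le_eqVlt => /predU1P[<-|t0].
    by rewrite powR0 ?mulr_ge0 ?powR_ge0// gt_eqF// (lt_le_trans _ (le_trans a1 ab)).
  by rewrite (le_trans (ger_powR _ ab)) ?t0// ler_peMl// powR_ge0.
rewrite (_ : b = (b - a) + a); last by lra.
rewrite powRD; last by rewrite (gt_eqF (lt_trans _ t1))// implybT.
rewrite ler_wpM2r ?powR_ge0// (le_trans (ler_powR (ltW t1) (_ : b - a <= e)))//.
  by lra.
by rewrite ge0_ler_powR// nnegrE ?(le_trans _ T1).
Qed.

Lemma le_powR_addr1 t a : 0 <= t -> 1 <= a -> t <= t `^ a + 1.
Proof.
move=> t0 a1; have [t1|t1] := leP t 1.
  by rewrite (le_trans t1)// lerDr powR_ge0.
by rewrite (le_trans (le1r_powR (ltW t1) a1))// lerDl.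
Qed.

(** [(s + t) / (l + l')] is the convex combination of [s / l] and [t / l'] with weights proportional
    to [l] and [l']. This is the pointwise content of the triangle inequality for the Luxemburg
    norm. *)
Lemma powR_convex_div s t l l' a : 0 <= s -> 0 <= t -> 0 < l -> 0 < l' ->
  1 <= a ->
  ((s + t) / (l + l')) `^ a <=
  l / (l + l') * (s / l) `^ a + l' / (l + l') * (t / l') `^ a.
Proof.
move=> s0 t0 l0 l'0 a1.
have ll0 : 0 < l + l' by rewrite addr_gt0.
have w0 : 0 <= l / (l + l') by rewrite divr_ge0// ltW.
have w1 : l / (l + l') <= 1 by rewrite ler_pdivrMr// mul1r lerDl ltW.
have := @convex_powR R a a1 (Itv01 w0 w1) (s / l) (t / l').
rewrite !inE/= !in_itv/= !andbT !divr_ge0// ?(ltW l0) ?(ltW l'0)//.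
move=> /(_ isT isT); rewrite !convRE /unstable.onem/=.
have -> : 1 - l / (l + l') = l' / (l + l') by field; rewrite gt_eqF.
rewrite [X in X `^ _ <= _ -> _](_ : _ = (s + t) / (l + l'))//.
rewrite [LHS]convRE /unstable.onem/=.
by field; rewrite !gt_eqF.
Qed.

Lemma continuous_normr_powR a : 1 <= a -> continuous (fun t => `|t| `^ a).
Proof.
move=> a1 t; have a0 : 0 < a by rewrite (lt_le_trans _ a1).
(* Away from [0] continuity follows from differentiability; at [0] it comes from [|x| ^ a <= |x|]
   for [|x| < 1]. *)
have [->|t0] := eqVneq t 0.
  rewrite /continuous_at normr0 powR0 ?gt_eqF//.
  apply/cvgr0Pnorm_lt => e e0; near=> x.
  have x1 : `|x| < 1 by near: x; apply: cvgr0_norm_lt => //; exact: cvg_id.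
  have xe : `|x| < e by near: x; apply: cvgr0_norm_lt => //; exact: cvg_id.
  rewrite ger0_norm ?powR_ge0//.
  have [->|x0] := eqVneq x 0; first by rewrite normr0 powR0 ?gt_eqF.
  by rewrite (le_lt_trans _ xe)// ge1r_powR// normr_gt0 x0 ltW.
apply: (@continuous_comp _ _ _ (@Num.norm _ R^o) (fun s => s `^ a)).
  exact: norm_continuous.
apply: differentiable_continuous; apply/derivable1_diffP.
by apply: derivable_powR; rewrite in_itv/= andbT normr_gt0.
Unshelve. all: by end_near. Qed.

Lemma powR_lt_near0 T e : 1 <= T -> 1 < e -> \forall d \near 0^'+, T `^ d < e.
Proof.
move=> T1 e1; have [->|] := eqVneq T 1; first by near=> d; rewrite powR1.
move=> T1'; have {}T1 : 1 < T by rewrite lt_neqAle eq_sym T1'.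
near=> d; rewrite /powR gt_eqF ?(lt_trans _ T1)// -(@lnK _ e) ?posrE ?(lt_trans _ e1)//.
rewrite ltr_expR -ltr_pdivlMr ?ln_gt0//.
near: d; apply: nbhs_right_lt; rewrite divr_gt0 ?ln_gt0//.
Unshelve. all: by end_near. Qed.

End powR_extra.

(** * Modular and Luxemburg norm on a set of finite measure *)

Section variable_exponent.
Context d (T : measurableType d) (R : realType).
Variable mu : {measure set T -> \bar R}.
Variable D : set T.
Hypothesis mD : measurable D.
Hypothesis fD : (mu D < +oo)%E.
Implicit Types (p q u v w : T -> R) (l k e c : R).

(* At Lebesgue measure these are convertible to [modular] and [Lpx_norm]. *)
Definition vmodular p u : \bar R := (\int[mu]_(x in D) (`|u x| `^ p x)%:E)%E.

Definition vnorm p u : \bar R :=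
  ereal_inf [set l%:E | l in
    [set l : R | 0 < l /\ (vmodular p (fun x => (u x / l)%R) <= 1)%E]].

Let m := fine (mu D).

Let mE : mu D = m%:E.
Proof. by rewrite fineK// ge0_fin_numE. Qed.

Let m0 : 0 <= m. Proof. by rewrite fine_ge0. Qed.

Definition exponent p :=
  measurable_fun D p /\ forall x, D x -> 1 <= p x.

Lemma measurable_vmodular p u : exponent p -> measurable_fun D u ->
  measurable_fun D (fun x => (`|u x| `^ p x)%:E).
Proof.
(* Base and exponent both vary, so the cases of the definition are treated apart: the indicator of
   [p x = 0] where the base vanishes, [expR (p x * ln |u x|)] elsewhere. *)
move=> [mp _] mu_; apply/measurable_EFinP; rewrite /powR.
have mabs : measurable_fun D (fun x => `|u x|) by exact: measurableT_comp.
apply: measurable_fun_if => //.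
- exact: measurable_fun_eqr.
- apply: (measurable_funS mD); first exact: subIsetl.
  rewrite (_ : (fun _ => _) = (fun x => if p x == 0 then 1 else 0)); last first.
    by apply/funext => x; case: eqP.
  by apply: measurable_fun_if => //; exact: measurable_fun_eqr.
- apply: (measurable_funS mD); first exact: subIsetl.
  apply: measurableT_comp; first exact: measurable_expR.
  apply: measurable_funM => //.
  by apply: measurableT_comp mabs; exact: measurable_ln.
Qed.

Lemma vmodular_ge0 p u : (0 <= vmodular p u)%E.
Proof. by apply: integral_ge0 => x _; rewrite lee_fin powR_ge0. Qed.

Lemma integral_cst_fine e : (\int[mu]_(x in D) e%:E = (e * m)%:E)%E.
Proof. by rewrite integral_cst//= mE EFinM. Qed.

Lemma vmodular_le_affine p q u v k e : exponent p -> exponent q ->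
  measurable_fun D u -> measurable_fun D v -> 0 <= k -> 0 <= e ->
  {ae mu, forall x, D x -> `|u x| `^ p x <= k * `|v x| `^ q x + e} ->
  (vmodular p u <= k%:E * vmodular q v + (e * m)%:E)%E.
Proof.
move=> ep eq mu_ mv k0 e0 uv.
have mkv : measurable_fun D (fun x => k%:E * (`|v x| `^ q x)%:E)%E.
  by apply: measurable_funeM; exact: measurable_vmodular.
rewrite -integral_cst_fine -ge0_integralZl_EFin//; last exact: measurable_vmodular.
rewrite -ge0_integralD//; last by move=> x _; rewrite -EFinM lee_fin mulr_ge0 ?powR_ge0.
apply: ae_ge0_le_integral => //.
- exact: measurable_vmodular.
- by move=> x _; rewrite -EFinM -EFinD lee_fin addr_ge0 ?mulr_ge0 ?powR_ge0.
- exact: emeasurable_funD.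
Qed.

Lemma vmodular_leM p q u v k : exponent p -> exponent q ->
  measurable_fun D u -> measurable_fun D v -> 0 <= k ->
  {ae mu, forall x, D x -> `|u x| `^ p x <= k * `|v x| `^ q x} ->
  (vmodular p u <= k%:E * vmodular q v)%E.
Proof.
move=> ep eq mu_ mv k0 uv; rewrite -[leRHS]adde0 -[0%E]/((0 : R)%:E) -(mul0r m).
by apply: vmodular_le_affine => //; apply: filterS uv => x; rewrite addr0.
Qed.

Lemma measurable_fun_divr u l : measurable_fun D u ->
  measurable_fun D (fun x => u x / l).
Proof. by move=> mu_; apply: measurable_funM. Qed.

Lemma normr_div u l x : 0 < l -> `|u x / l| = `|u x| / l.
Proof. by move=> l0; rewrite normrM normfV (gtr0_norm l0). Qed.

(** For exponents at least [1], [c ^ (- p x) <= c ^ -1]. Hence a modular bounded by [c] at scale [l]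
    is at most [1] at scale [c * l], which is how modular bounds become norm bounds. *)
Lemma vmodular_divM p u l c : exponent p -> measurable_fun D u ->
  0 < l -> 1 <= c ->
  (vmodular p (fun x => (u x / (c * l))%R) <=
   c^-1%:E * vmodular p (fun x => (u x / l)%R))%E.
Proof.
move=> ep mu_ l0 c1; have c0 : 0 < c by rewrite (lt_le_trans _ c1).
apply: vmodular_leM => //; [exact: measurable_fun_divr..|by rewrite invr_ge0 ltW|].
apply/aeW => x Ox; rewrite !normr_div ?mulr_gt0//.
rewrite invfM mulrCA ge1r_powRZ ?invr_gt0 ?c0 ?invf_le1//.
  by rewrite divr_ge0// ltW.
by case: ep => _; exact.
Qed.

Lemma vmodular_div_le1 p u l l' : exponent p -> measurable_fun D u ->
  0 < l -> l <= l' -> (vmodular p (fun x => (u x / l)%R) <= 1)%E ->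
  (vmodular p (fun x => (u x / l')%R) <= 1)%E.
Proof.
move=> ep mu_ l0 ll' h.
have c1 : 1 <= l' / l by rewrite ler_pdivlMr// mul1r.
rewrite (_ : l' = l' / l * l); last by rewrite divfK ?gt_eqF.
apply: (le_trans (vmodular_divM ep mu_ l0 c1)).
rewrite -[leRHS]mule1 lee_pmul// ?vmodular_ge0// lee_fin ?invr_ge0 ?(le_trans _ c1)//.
by rewrite invf_le1// (lt_le_trans _ c1).
Qed.

Lemma vnorm_le p u l : 0 < l ->
  (vmodular p (fun x => (u x / l)%R) <= 1)%E ->
  (vnorm p u <= l%:E)%E.
Proof. by move=> l0 h; apply: ereal_inf_lbound; exists l. Qed.

Lemma vnorm_lt p u (y : \bar R) : (vnorm p u < y)%E ->
  exists l, [/\ 0 < l, (l%:E < y)%E &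
                (vmodular p (fun x => (u x / l)%R) <= 1)%E].
Proof. by move=> /ereal_inf_lt[_ [l [l0 h] <-] ly]; exists l. Qed.

Lemma vnorm_lt_vmodular p u l : exponent p -> measurable_fun D u ->
  (vnorm p u < l%:E)%E ->
  0 < l /\ (vmodular p (fun x => (u x / l)%R) <= 1)%E.
Proof.
move=> ep mu_ /vnorm_lt[l' [l'0]]; rewrite lte_fin => l'l h; split.
  exact: lt_trans l'l.
exact: vmodular_div_le1 (ltW l'l) h.
Qed.

Lemma vnorm_ge0 p u : (0 <= vnorm p u)%E.
Proof. by apply: le_ereal_inf_tmp => _ [l [l0 _] <-]; rewrite lee_fin ltW. Qed.

Lemma vnorm0 p u : exponent p -> (forall x, D x -> u x = 0) ->
  vnorm p u = 0%E.
Proof.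
move=> [_ p1] u0; apply/eqP; rewrite eq_le vnorm_ge0 andbT.
apply/lee_addgt0Pr => e e0; rewrite add0e; apply: vnorm_le => //.
rewrite /vmodular (eq_integral (cst 0%E)) ?integral0 ?lee01// => x; rewrite inE => Ox.
by rewrite u0// mul0r normr0 powR0// gt_eqF// (lt_le_trans _ (p1 _ Ox)).
Qed.

Lemma vnorm_lty p u : exponent p -> measurable_fun D u ->
  (vmodular p u < +oo)%E -> (vnorm p u < +oo)%E.
Proof.
move=> ep mu_ fu; set M := fine (vmodular p u).
have ME : vmodular p u = M%:E by rewrite fineK// ge0_fin_numE// vmodular_ge0.
have M0 : 0 <= M by rewrite fine_ge0// vmodular_ge0.
(* The scale [1 + M] is at least [1] and exceeds the modular [M], so the modular of the scaled
   function is at most [1]. *)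
apply: (@le_lt_trans _ _ (1 + M)%:E); last by rewrite ltry.
have M1 : 1 <= 1 + M by rewrite lerDl.
apply: vnorm_le; first by rewrite (lt_le_trans _ M1).
have := vmodular_divM ep mu_ ltr01 M1; rewrite mulr1 => /le_trans; apply.
rewrite (_ : (fun x => u x / 1) = u); last by apply/funext => x; rewrite divr1.
by rewrite ME -EFinM lee_fin ler_pdivrMl ?(lt_le_trans _ M1)// mulr1 lerDr.
Qed.

(** At a scale where the [q]-modular is at most [1], the [p]-modular is at most [1 + e * m];
    enlarging the scale by this factor brings it back to [1]. *)
Lemma le_vnorm_exponent p q u e : exponent p -> exponent q ->
  measurable_fun D u -> 0 <= e ->
  {ae mu, forall x, D x -> p x <= q x <= p x + e} ->
  (vnorm p u <= (1 + e * m)%:E * vnorm q u)%E.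
Proof.
move=> ep eq mu_ e0 pq.
have c1 : 1 <= 1 + e * m by rewrite lerDl mulr_ge0.
have c0 : 0 < 1 + e * m by rewrite (lt_le_trans _ c1).
rewrite -lee_pdivrMl//; apply: le_ereal_inf_tmp => _ [l [l0 h] <-].
rewrite lee_pdivrMl// -EFinM; apply: vnorm_le; first by rewrite mulr_gt0.
apply: (le_trans (vmodular_divM ep mu_ l0 c1)).
rewrite lee_pdivrMl// mule1.
have mul := measurable_fun_divr l mu_.
apply: (@le_trans _ _ (1%:E * vmodular q (fun x => (u x / l)%R) + (e * m)%:E)%E).
  apply: vmodular_le_affine => //.
  apply: filterS pq => x + Dx => /(_ Dx)/andP[pq qp].
  by rewrite mul1r; apply: powR_le_addr => //; exact: ep.2.
by rewrite mul1e EFinD leeD2r.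
Qed.

Lemma vmodular_lty_exponent p q u e : exponent p -> exponent q ->
  measurable_fun D u -> 0 <= e ->
  {ae mu, forall x, D x -> p x <= q x <= p x + e} ->
  (vmodular q u < +oo)%E -> (vmodular p u < +oo)%E.
Proof.
move=> ep eq mu_ e0 pq fu.
apply: (@le_lt_trans _ _ (1%:E * vmodular q u + (e * m)%:E)%E).
  apply: vmodular_le_affine => //.
  apply: filterS pq => x + Dx => /(_ Dx)/andP[pq qp].
  by rewrite mul1r; apply: powR_le_addr => //; exact: ep.2.
by rewrite mul1e lte_add_pinfty// ltry.
Qed.

(** The reverse comparison, towards the larger exponent, uses a bound [M] on [|u| / l]: the factor
    [M ^ e] is lost in the modular and then in the norm. *)
Lemma vnorm_le_bounded p q u e l M : exponent p -> exponent q ->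
  measurable_fun D u -> 0 < l -> 1 <= M -> (forall x, D x -> `|u x| / l <= M) ->
  {ae mu, forall x, D x -> p x <= q x <= p x + e} ->
  (vmodular p (fun x => (u x / l)%R) <= 1)%E -> 0 <= e ->
  (vnorm q u <= (M `^ e * l)%:E)%E.
Proof.
move=> ep eq mu_ l0 M1 uM pq h e0.
have c1 : 1 <= M `^ e by rewrite -(@powRr0 _ M) ler_powR.
have c0 : 0 < M `^ e by rewrite (lt_le_trans _ c1).
apply: vnorm_le; first by rewrite mulr_gt0.
apply: (le_trans (vmodular_divM eq mu_ l0 c1)).
rewrite lee_pdivrMl// mule1.
apply: (@le_trans _ _ ((M `^ e)%:E * vmodular p (fun x => (u x / l)%R))%E); last first.
  by rewrite -[leRHS]mule1 lee_pmul2l.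
have mul := measurable_fun_divr l mu_.
apply: vmodular_leM => //; first exact: ltW.
apply: filterS pq => x + Dx => /(_ Dx)/andP[pq qp].
apply: powR_le_mulr => //; last exact: ep.2.
by rewrite normr_ge0/= normr_div// uM.
Qed.

(** Triangle inequality with strict bounds, which supply admissible scales for [u] and [v]. Since
    [w] is only dominated pointwise, it also applies to Euclidean norms of vector fields. *)
Lemma vnorm_ltD p u v w a b : exponent p ->
  measurable_fun D u -> measurable_fun D v -> measurable_fun D w ->
  (forall x, D x -> `|w x| <= `|u x| + `|v x|) ->
  (vnorm p u < a%:E)%E -> (vnorm p v < b%:E)%E -> (vnorm p w < (a + b)%:E)%E.
Proof.
move=> ep mu_ mv mw wuv /vnorm_lt[l [l0 la ul]] /vnorm_lt[l' [l'0 l'b vl']].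
apply: (@le_lt_trans _ _ (l + l')%:E); last by rewrite lte_fin ltrD// -lte_fin.
have ll0 : 0 < l + l' by rewrite addr_gt0.
apply: (vnorm_le ll0).
have k0 : (0 <= (l / (l + l'))%:E)%E by rewrite lee_fin divr_ge0// ltW.
have k'0 : (0 <= (l' / (l + l'))%:E)%E by rewrite lee_fin divr_ge0// ltW.
apply: (@le_trans _ _ ((l / (l + l'))%:E * vmodular p (fun x => (u x / l)%R) +
    (l' / (l + l'))%:E * vmodular p (fun x => (v x / l')%R))%E); last first.
  apply: (@le_trans _ _ ((l / (l + l'))%:E * 1 + (l' / (l + l'))%:E * 1)%E).
    exact: (leeD (lee_wpmul2l k0 ul) (lee_wpmul2l k'0 vl')).
  by rewrite !mule1 -EFinD -mulrDl divff// gt_eqF.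
have mul := measurable_vmodular ep (measurable_fun_divr l mu_).
have mvl := measurable_vmodular ep (measurable_fun_divr l' mv).
have mwl := measurable_vmodular ep (measurable_fun_divr (l + l') mw).
rewrite -!ge0_integralZl_EFin//.
rewrite -ge0_integralD//; [|by move=> x _; rewrite -EFinM lee_fin mulr_ge0 ?powR_ge0
  |exact: measurable_funeM|by move=> x _; rewrite -EFinM lee_fin mulr_ge0 ?powR_ge0
  |exact: measurable_funeM].
apply: ge0_le_integral => //.
  by apply: emeasurable_funD; exact: measurable_funeM.
move=> x Dx; rewrite -!EFinM -EFinD lee_fin.
have p1 : 1 <= p x by exact: ep.2.
rewrite !normr_div//; apply: (le_trans _ (powR_convex_div _ _ _ _ _)) => //.
apply: ge0_ler_powR; rewrite ?nnegrE ?(le_trans _ p1)//.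
- by rewrite divr_ge0// ltW.
- by rewrite divr_ge0 ?addr_ge0// ltW.
- by rewrite ler_pM2r ?invr_gt0// wuv.
Qed.

(** Integrates [t <= t ^ p + 1] at [t = |u| / a]. *)
Lemma vnorm_lt_L1 p u a : exponent p -> measurable_fun D u ->
  (vnorm p u < a%:E)%E ->
  (\int[mu]_(x in D) `|u x|%:E <= (a * (1 + m))%:E)%E.
Proof.
move=> ep mu_ /(vnorm_lt_vmodular ep mu_)[a0 h].
have mul := measurable_vmodular ep (measurable_fun_divr a mu_).
apply: (@le_trans _ _ (\int[mu]_(x in D)
    (a%:E * ((`|u x / a| `^ p x)%:E + 1%:E)))%E).
  apply: ge0_le_integral => //.
  - by apply/measurable_EFinP; exact: measurableT_comp.
  - by apply: measurable_funeM; exact: emeasurable_funD.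
  move=> x Dx; rewrite -EFinD -EFinM lee_fin -ler_pdivrMl// mulrC.
  by rewrite -normr_div// le_powR_addr1//; exact: ep.2.
rewrite ge0_integralZl_EFin//; last 3 first.
- by move=> x _; rewrite -EFinD lee_fin addr_ge0 ?powR_ge0.
- exact: emeasurable_funD.
- exact: ltW.
rewrite ge0_integralD//.
rewrite integral_cst_fine mul1r EFinM lee_pmul2l//.
by rewrite EFinD; exact: (leeD2r _ h).
Qed.

Lemma vnorm_eq0_ae p u : exponent p -> measurable_fun D u ->
  vnorm p u = 0%E -> {ae mu, forall x, D x -> u x = 0}.
Proof.
move=> ep mu_ u0.
have mu' : measurable_fun D (EFin \o u) by exact/measurable_EFinP.
suff : (\int[mu]_(x in D) `|(EFin \o u) x| = 0)%E.
  by move=> /(ae_eq_integral_abs _ mD mu'); apply: filterS => x + Dx => /(_ Dx)[].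
apply/eqP; rewrite eq_le integral_ge0// andbT.
apply/lee_addgt0Pr => e e0; rewrite add0e.
have m1 : 0 < 1 + m by rewrite ltr_wpDr.
rewrite (_ : e = e / (1 + m) * (1 + m)); last by rewrite divfK ?gt_eqF.
by apply: (vnorm_lt_L1 ep) => //; rewrite u0 lte_fin divr_gt0.
Qed.

Lemma vnorm_ae0 p u : exponent p -> measurable_fun D u ->
  {ae mu, forall x, D x -> u x = 0} -> vnorm p u = 0%E.
Proof.
move=> ep mu_ u0; apply/eqP; rewrite eq_le vnorm_ge0 andbT.
apply/lee_addgt0Pr => e e0; rewrite add0e; apply: vnorm_le => //.
have mue := measurable_fun_divr e mu_.
rewrite (@le_trans _ _ 0%E)// -(mul0e (vmodular p u)).
apply: vmodular_leM => //; apply: filterS u0 => x + Dx => /(_ Dx) ->.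
by rewrite !mul0r normr0 powR0// gt_eqF// (lt_le_trans _ (ep.2 _ Dx)).
Qed.

(** The geometric rate makes the [L^1] norms of [u - f n] summable, so the series of [|u - f n|]
    converges at almost every point and its terms tend to [0], without extraction of a
    subsequence. *)
Lemma ae_cvg_of_vnorm p (f : (T -> R)^nat) u : exponent p ->
  measurable_fun D u -> (forall n, measurable_fun D (f n)) ->
  (forall n, (vnorm p (u \- f n)%R < ((2 ^ n.+1)%:R^-1)%:E)%E) ->
  {ae mu, forall x, D x -> f n x @[n --> \oo] --> u x}.
Proof.
move=> ep mu_ mf fu.
have mB n : measurable_fun D (u \- f n) by exact: measurable_funB.
have md n : measurable_fun D (fun x => `|(u \- f n) x|%:E).
  by apply/measurable_EFinP; exact: measurableT_comp.
have m1 : 0 <= 1 + m by rewrite addr_ge0.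
have int_lty : (\int[mu]_(x in D) (\sum_(n <oo) `|(u \- f n) x|%:E) < +oo)%E.
  rewrite integral_nneseries//.
  apply: (@le_lt_trans _ _ (1 + m)%:E); last by rewrite ltry.
  rewrite (le_trans _ (epsilon_trick0 xpredT m1))//.
  apply: lee_nneseries => n _; first by move=> _; exact: integral_ge0.
  by rewrite mulrC; exact: (vnorm_lt_L1 ep).
have int_sum : mu.-integrable D (fun x => \sum_(n <oo) `|(u \- f n) x|%:E)%E.
  apply/integrableP; split; first exact: ge0_emeasurable_sum.
  under eq_integral do rewrite gee0_abs ?nneseries_ge0//.
  exact: int_lty.
have := integrable_ae mD int_sum; apply: filterS => x + Dx => /(_ Dx) sx.
suff : (fun n => `|(u \- f n) x|) @ \oo --> (0 : R).
  move=> /norm_cvg0 h; rewrite -[u x]subr0.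
  rewrite (_ : (fun n => f n x) = (fun n => u x - (u \- f n) x)); last first.
    by apply/funext => n /=; rewrite subKr.
  by apply: cvgB => //; exact: cvg_cst.
apply: cvg_series_cvg_0; apply: nondecreasing_is_cvgn.
  by apply: nondecreasing_series => n _ _.
exists (fine (\sum_(n <oo) `|(u \- f n) x|%:E)%E) => _ [n _ <-].
rewrite -lee_fin fineK// /series/= -sumEFin.
exact: nneseries_lim_ge.
Qed.

(** At scale [c + e] all modulars of the [f n] are at most [1], and Fatou's lemma passes this on to
    [u]. The scale [c] itself may be [0], and the infimum yields admissible scales only above it. *)
Lemma vnorm_fatou p (f : (T -> R)^nat) u c : exponent p ->
  measurable_fun D u -> (forall n, measurable_fun D (f n)) ->
  {ae mu, forall x, D x -> f n x @[n --> \oo] --> u x} ->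
  0 <= c -> (forall n, (vnorm p (f n) <= c%:E)%E) -> (vnorm p u <= c%:E)%E.
Proof.
move=> ep mu_ mf fu c0 fc; apply/lee_addgt0Pr => e e0; rewrite -EFinD.
have ce : c < c + e by rewrite ltrDl.
have ce0 : 0 < c + e by rewrite (le_lt_trans c0).
apply: (vnorm_le ce0).
have mfc n := measurable_vmodular ep (measurable_fun_divr (c + e) (mf n)).
have muc := measurable_vmodular ep (measurable_fun_divr (c + e) mu_).
have mlim : measurable_fun D
    (fun x => limn_einf (fun n => (`|f n x / (c + e)| `^ p x)%:E)).
  apply: (@measurableT_comp _ _ _ _ _ _ (@oppe R)) => //.
  apply: measurable_fun_limn_esup => n.
  exact: (@measurableT_comp _ _ _ _ _ _ (@oppe R)).
have h n : (vmodular p (fun x => (f n x / (c + e))%R) <= 1)%E.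
  by apply: (vnorm_lt_vmodular ep (mf n) _).2; rewrite (le_lt_trans (fc n))// lte_fin.
apply: (@le_trans _ _ (\int[mu]_(x in D)
    limn_einf (fun n => (`|f n x / (c + e)| `^ p x)%:E))%E).
  apply: ae_ge0_le_integral => //.
    move=> x _; rewrite limn_einf_lim; apply: lime_ge; first exact: is_cvg_einfs.
    apply: nearW => n; apply: le_ereal_inf_tmp => _ [k _ <-].
    by rewrite lee_fin powR_ge0.
  apply: filterS fu => x + Dx => /(_ Dx) fx.
  suff : (fun n => (`|f n x / (c + e)| `^ p x)%:E) @ \oo -->
      (`|u x / (c + e)| `^ p x)%:E.
    by move=> /cvg_limn_einf_sup[-> _].
  apply: cvg_EFin; first exact: nearW.
  apply: (@cvg_comp _ _ _ (fun n => f n x / (c + e)) (fun t => `|t| `^ p x)).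
    by apply: cvgM fx _; exact: cvg_cst.
  by apply: continuous_normr_powR; exact: ep.2.
apply: (le_trans (fatou mu mD mfc _)); first by move=> n x _; rewrite lee_fin powR_ge0.
rewrite limn_einf_lim; apply: lime_le; first exact: is_cvg_einfs.
apply: nearW => n; apply: ereal_inf_le.
exists (vmodular p (fun x => (f n x / (c + e))%R)) => //.
by exists n => /=.
Qed.

End variable_exponent.

(** * Test functions *)

Section integral_extra.
Context d (T : measurableType d) (R : realType).
Variable mu : {measure set T -> \bar R}.

(** The image measure of [mu] under [phi] agrees with [mu] on measurable sets. It is applied to
    translations. *)
Lemma integral_measure_preserving (phi : T -> T) (f : T -> \bar R) :
  measurable_fun [set: T] phi ->
  (forall A, measurable A -> mu (phi @^-1` A) = mu A) ->
  mu.-integrable [set: T] f ->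
  mu.-integrable [set: T] (f \o phi) /\
  (\int[mu]_x (f \o phi) x = \int[mu]_x f x)%E.
Proof.
move=> mphi phiP intf; have mf := measurable_int _ intf.
have intfphi : mu.-integrable [set: T] (f \o phi).
  move/integrableP : intf => [_ fy]; apply/integrableP; split.
    exact: measurableT_comp.
  apply: le_lt_trans fy.
  rewrite (_ : (\int[mu]_x `|(f \o phi) x|)%E =
    (\int[mu]_(x in phi @^-1` setT) ((abse \o f) \o phi) x)%E); last first.
    by rewrite preimage_setT.
  rewrite -ge0_integral_pushforward//=.
  rewrite (_ : (\int[pushforward mu phi]_y `|f y|)%E = (\int[mu]_y `|f y|)%E)//.
    by apply: eq_measure_integral => A mA _; exact: phiP.
  exact: measurableT_comp.
split=> //.
rewrite (_ : (\int[mu]_x (f \o phi) x)%E =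
    (\int[mu]_(x in phi @^-1` setT) (f \o phi) x)%E); last by rewrite preimage_setT.
rewrite -integral_pushforward//.
by apply: eq_measure_integral => A mA _; exact: phiP.
Qed.

Lemma measurable_fun_increment (phi : T -> T) (f : T -> R) (c : R) :
  measurable_fun [set: T] phi -> measurable_fun [set: T] f ->
  measurable_fun [set: T] (fun x => c * (f (phi x) - f x)).
Proof.
move=> mphi mf; apply: measurable_funM => //; apply: measurable_funB => //.
exact: measurableT_comp.
Qed.

Lemma integrable_bounded_supp (B : set T) (f : T -> R) (M : R) :
  measurable B -> (mu B < +oo)%E -> measurable_fun [set: T] f ->
  (forall x, `|f x| <= M) -> (forall x, ~ B x -> f x = 0) ->
  mu.-integrable [set: T] (EFin \o f).
Proof.
move=> mB fB mf fM f0.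
apply: (@le_integrable _ _ _ _ _ measurableT _ (fun x => (M%:E * (\1_B x)%:E)%E)).
- exact/measurable_EFinP.
- move=> x _ /=; have [Bx|Bx] := pselect (B x).
    by rewrite lee_fin indicE mem_set// mulr1 (le_trans (fM x))// ler_norm.
  by rewrite f0// normr0 lee_fin.
- apply: integrableZl => //; apply/integrableP; split.
    by apply/measurable_EFinP; exact: measurable_indic.
  under eq_integral do rewrite gee0_abs ?lee_fin//.
  by rewrite integral_indic// setIT.
Qed.

Lemma integral_cvg_bounded_supp (B : set T) (f_ : (T -> R)^nat) (f : T -> R) (M : R) :
  measurable B -> (mu B < +oo)%E -> (forall n, measurable_fun [set: T] (f_ n)) ->
  measurable_fun [set: T] f ->
  (forall n x, `|f_ n x| <= M) -> (forall n x, ~ B x -> f_ n x = 0) ->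
  (forall x, f_ n x @[n --> \oo] --> f x) ->
  (fun n => \int[mu]_x (f_ n x)%:E)%E @ \oo --> (\int[mu]_x (f x)%:E)%E.
Proof.
move=> mB fB mf_ mf fM f0 ff.
have intg : mu.-integrable [set: T] (fun x => (M%:E * (\1_B x)%:E)%E).
  apply: integrableZl => //; apply/integrableP; split.
    by apply/measurable_EFinP; exact: measurable_indic.
  under eq_integral do rewrite gee0_abs ?lee_fin//.
  by rewrite integral_indic// setIT.
have [] := @dominated_convergence _ _ _ mu _ measurableT
  (fun n x => (f_ n x)%:E) (fun x => (f x)%:E) (fun x => (M%:E * (\1_B x)%:E)%E) => //.
- by move=> n; exact/measurable_EFinP.
- exact/measurable_EFinP.
- apply/aeW => x _; apply: cvg_EFin; first exact: nearW.
  exact: ff.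
- apply/aeW => x n _ /=; have [Bx|Bx] := pselect (B x).
    by rewrite indicE mem_set// mule1 lee_fin.
  by rewrite f0// normr0 indicE memNset// mule0.
Qed.

End integral_extra.

(** * Partial derivatives of compactly supported functions *)

Section partial_derivatives.
Context {R : realType} {N : nat}.
Notation V := 'rV[R]_N.+1.
Local Notation mu := (@lebesgue_rV R N).
Implicit Types (f phi psi : V -> R) (i : 'I_N.+1) (x : V) (K : set V).

Local Notation e_ i := (delta_mx ord0 i : V).

Lemma compact_supp_bounded f K : compact K -> continuous f ->
  (forall x, ~ K x -> f x = 0) -> exists M : R, 0 <= M /\ forall x, `|f x| <= M.
Proof.
move=> cK cf f0.
have /compact_bounded[M [Mr MB]] : compact (f @` K).
  by apply: continuous_compact => //; exact: continuous_subspaceT.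
exists (`|M| + 1); split; first by rewrite addr_ge0.
move=> x; have [Kx|Kx] := pselect (K x).
  apply: MB; last by exists x.
  by rewrite (le_lt_trans (ler_norm M))// ltrDl.
by rewrite f0// normr0 addr_ge0.
Qed.

(** Off the closed support [f] vanishes near [x], and so do its difference quotients for small
    increments: differentiation does not enlarge the support. *)
Lemma partial_eq0 f i x : ~ closure [set x | f x != 0] x -> partial i f x = 0.
Proof.
move=> nx; have : \forall y \near x, f y = 0.
  have : nbhs x (~` closure [set x | f x != 0]).
    apply: open_nbhs_nbhs; split=> //; apply: closed_openC; exact: closed_closure.
  apply: filterS => y ny; apply/eqP/negP => /negP fy.
  by apply: ny; exact: subset_closure.
move=> fx0; rewrite /partial /derive; apply/cvg_lim => //.
have line_cvg : h *: e_ i + x @[h --> (0 : R)] --> x.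
  rewrite -[X in _ --> X]add0r -(scale0r (e_ i)).
  by apply: cvgD; [apply: cvgZr_tmp; exact: cvg_id|exact: cvg_cst].
have fl0 : \forall h \near (0 : R), f (h *: e_ i + x) = 0 := line_cvg _ fx0.
suff E : {near (0 : R)^', cst (0 : R) =1
    (fun h => h^-1 *: ((f \o shift x) (h *: e_ i) - f x))}.
  exact: cvg_trans (near_eq_cvg E) (cvg_cst _).
rewrite /dnbhs near_withinE; apply: filterS fl0 => h /= -> _.
by rewrite (nbhs_singleton fx0) subrr scaler0.
Qed.

Lemma line_is_derive f i x (t : R) : derivable f (x + t *: e_ i) (e_ i) ->
  is_derive t 1 (fun s : R => f (x + s *: e_ i)) (partial i f (x + t *: e_ i)).
Proof.
move=> df; set g := fun s : R => f (x + s *: e_ i).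
have E : (fun h : R => h^-1 *: ((g \o shift t) (h *: (1 : R)) - g t)) =
    (fun h : R => h^-1 *: ((f \o shift (x + t *: e_ i)) (h *: e_ i) - f (x + t *: e_ i))).
  apply/funext => h; congr (_ *: (_ - _)); rewrite /g/=; congr f.
  by rewrite [h *: 1]mulr1 scalerDl addrCA.
by apply: DeriveDef; rewrite /derivable /partial /derive E.
Qed.

(** The mean value theorem along a line bounds the difference quotients uniformly in [x] and [h],
    which gives the dominating constant for the limit under the integral. *)
Lemma increment_le f i (M : R) : continuous f ->
  (forall x, derivable f x (e_ i)) -> (forall x, `|partial i f x| <= M) ->
  forall x (h : R), 0 <= h -> `|f (x + h *: e_ i) - f x| <= M * h.
Proof.
move=> cf df fM x h h0.
have [|||c _] := @MVT_segment R (fun s : R => f (x + s *: e_ i))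
    (fun s => partial i f (x + s *: e_ i)) 0 h => //.
- by move=> s _; apply: line_is_derive.
- apply: continuous_subspaceT => s.
  apply: (@continuous_comp _ _ _ (fun s : R => x + s *: e_ i) f); last exact: cf.
  by apply: cvgD; [exact: cvg_cst|apply: cvgZr_tmp; exact: cvg_id].
rewrite scale0r addr0 subr0 => ->.
by rewrite normrM (ger0_norm h0) ler_wpM2r.
Qed.

Lemma measurable_norm_le (r : R) : measurable [set x : V | `|x| <= r].
Proof.
have mn : measurable_fun [set: V] (fun x : V => `|x|).
  by apply: continuous_measurable_rV; exact: norm_continuous.
rewrite (_ : [set _ | _] = [set: V] `&` (fun x : V => `|x|) @^-1` `]-oo, r]).
  exact: mn.
by rewrite setTI; apply/seteqP; split => x /=; rewrite in_itv.
Qed.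

Lemma norm_delta_mx_le i : `|e_ i| <= 1.
Proof.
rewrite /Num.norm/= mx_normrE; apply: bigmax_le => // -[j k] _ /=.
by rewrite mxE; case: (_ && _); rewrite ?normr1 ?normr0.
Qed.

Lemma integral_partial_eq0 f i : continuous f -> compact (closure [set x | f x != 0]) ->
  (forall x, derivable f x (e_ i)) -> continuous (partial i f) ->
  (\int[mu]_x (partial i f x)%:E = 0)%E.
Proof.
move=> cf cK df cp; set K := closure _ in cK.
have f0 x : ~ K x -> f x = 0.
  by move=> Kx; apply/eqP/negP => /negP fx; apply: Kx; exact: subset_closure.
have [M0 [M00 fM0]] := compact_supp_bounded cK cf f0.
have [M [M_0 pM]] := compact_supp_bounded cK cp (fun x => @partial_eq0 f i x).
have /compact_bounded[r' [r'r Kr']] := cK.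
pose r := `|r'| + 1.
have Kr x : K x -> `|x| <= r.
  by apply: Kr'; rewrite (le_lt_trans (ler_norm r'))// ltrDl.
(* Increments of length at most [1] move the support by at most [1], so all difference quotients
   vanish off this ball. *)
pose B := [set x : V | `|x| <= r + 1].
have mB : measurable B by exact: measurable_norm_le.
have fB : (mu B < +oo)%E.
  apply: lebesgue_rV_bounded; exists (r + 1); split; first exact: num_real.
  by move=> s rs x Bx; exact: (le_trans Bx (ltW rs)).
have mf := continuous_measurable_rV cf.
have mp := continuous_measurable_rV cp.
have intf : mu.-integrable [set: V] (EFin \o f).
  apply: (integrable_bounded_supp mB fB mf fM0) => x Bx; apply: f0 => /Kr xr.
  by apply: Bx; rewrite /B/= (le_trans xr)// lerDl.
pose h n : R := n.+1%:R^-1.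
have h0 n : 0 < h n by rewrite invr_gt0.
have h1 n : h n <= 1 by rewrite invf_le1// ler1n.
pose g n x := (h n)^-1 * (f (x + h n *: e_ i) - f x).
(* Derivatives are limits along punctured neighbourhoods of [0], so [h n != 0] has to be
   recorded. *)
have cvg_h : h n @[n --> \oo] --> 0^'.
  move=> A A0.
  have : \forall n \near \oo, h n != 0 -> A (h n) := @cvg_harmonic R _ A0.
  by apply: filterS => n; apply; rewrite gt_eqF.
have gp x : g n x @[n --> \oo] --> partial i f x.
  have := df x => /cvg_ex[l dfl].
  have -> : partial i f x = l by apply/cvg_lim.
  have := cvg_comp _ _ cvg_h dfl.
  apply: cvg_trans; apply: near_eq_cvg; apply: nearW => n /=.
  by rewrite /g [x + _]addrC.
have mg n : measurable_fun [set: V] (g n).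
  exact: measurable_fun_increment (measurable_shift _) mf.
have gM n x : `|g n x| <= M.
  rewrite normrM gtr0_norm ?invr_gt0// ler_pdivrMl// mulrC.
  exact: (increment_le cf df pM _ (ltW (h0 n))).
have g0 n x : ~ B x -> g n x = 0.
  move=> Bx; rewrite /g f0 ?f0 ?subrr ?mulr0//.
    by move=> /Kr xr; apply: Bx; rewrite /B/= (le_trans xr)// lerDl.
  move=> /Kr xr; apply: Bx; rewrite /B/=.
  rewrite -[x](addrK (h n *: e_ i)) (le_trans (ler_normB _ _))// lerD//.
  rewrite normrZ gtr0_norm//.
  by rewrite (le_trans (ler_pM _ _ (h1 n) (norm_delta_mx_le i)))// ?mulr1 ?(ltW (h0 n)).
have := integral_cvg_bounded_supp mB fB mg mp gM g0 gp.
(* [f] and its translates have the same finite integral, so each difference quotient integrates to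
   [0]. *)
have -> : (fun n => \int[mu]_x (g n x)%:E)%E = cst 0%E.
  apply/funext => n /=.
  have [intfh ifh] := integral_measure_preserving (measurable_shift (h n *: e_ i))
    (fun A _ => lebesgue_rV_shift _ A) intf.
  under eq_integral do rewrite /g EFinM.
  have intB := integrableB measurableT intfh intf.
  rewrite (integralZl measurableT intB (h n)^-1).
  by rewrite (integralB measurableT intfh intf) ifh subee ?mule0// integrable_fin_num.
by move=> /(cvg_lim (@ereal_hausdorff R)) <-; rewrite lim_cst//; exact: ereal_hausdorff.
Qed.

End partial_derivatives.

(** * Triangle inequality and measurability for the Euclidean norm *)

Section euclidean_norm.
Context {R : realType} {N : nat}.
Notation V := 'rV[R]_N.+1.
Implicit Types x y : V.

Lemma euclid_norm_ge0 x : 0 <= euclid_norm x.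
Proof. exact: sqrtr_ge0. Qed.

Lemma euclid_norm0 : euclid_norm (0 : V) = 0.
Proof.
by rewrite /euclid_norm big1 ?sqrtr0// => i _; rewrite mxE expr0n.
Qed.

Lemma le_euclid_normB x y : euclid_norm (x - y) <= euclid_norm x + euclid_norm y.
Proof.
rewrite -(@ler_pXn2r _ 2)// ?nnegrE ?addr_ge0 ?euclid_norm_ge0//.
set P := \sum_i x ord0 i * y ord0 i.
have sq z : euclid_norm z ^+ 2 = \sum_i z ord0 i ^+ 2.
  by rewrite sqr_sqrtr// sumr_ge0// => i _; rewrite sqr_ge0.
set a := euclid_norm x; set b := euclid_norm y.
have a0 : 0 <= a by exact: euclid_norm_ge0.
have b0 : 0 <= b by exact: euclid_norm_ge0.
have -> : euclid_norm (x - y) ^+ 2 = a ^+ 2 + b ^+ 2 - 2 * P.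
  rewrite !sq /P mulr_sumr -big_split -sumrB; apply: eq_bigr => i _ /=.
  by rewrite !mxE; ring.
suff : - P <= a * b by rewrite sqrrD; lra.
(* Expanding [|b x + a y|^2] with [a = |x|] and [b = |y|] gives the Cauchy-Schwarz inequality after
   division by [2 a b]; zero vectors are treated apart. *)
have key : 0 <= 2 * (a * b) * (a * b + P).
  have -> : 2 * (a * b) * (a * b + P) =
      \sum_i (b * x ord0 i + a * y ord0 i) ^+ 2.
    rewrite (eq_bigr (fun i => b ^+ 2 * x ord0 i ^+ 2 + a ^+ 2 * y ord0 i ^+ 2 +
      2 * (a * b) * (x ord0 i * y ord0 i))); last by move=> i _; ring.
    by rewrite !big_split/= -!mulr_sumr -!sq -/a -/b -/P; ring.
  by apply: sumr_ge0 => i _; exact: sqr_ge0.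
have zero z : euclid_norm z = 0 -> forall i, z ord0 i = 0.
  move=> z0 i; have : \sum_i z ord0 i ^+ 2 = 0 by rewrite -sq z0 expr0n.
  move=> /eqP; rewrite psumr_eq0; last by move=> j _; exact: sqr_ge0.
  by move=> /allP/(_ i); rewrite mem_index_enum sqrf_eq0 => /(_ isT)/eqP.
have [a_0|a_0] := eqVneq a 0.
  rewrite /P big1 ?oppr0 ?mulr_ge0// => i _.
  by rewrite zero// mul0r.
have [b_0|b_0] := eqVneq b 0.
  rewrite /P big1 ?oppr0 ?mulr_ge0// => i _.
  by rewrite [y _ _]zero// mulr0.
have ab : 0 < 2 * (a * b) by rewrite !mulr_gt0// lt_neqAle eq_sym (a_0, b_0).
by move: key; rewrite pmulr_rge0//; lra.
Qed.

Lemma measurable_euclid_norm d (T : measurableType d) (D : set T) (g : T -> V) :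
  (forall i, measurable_fun D (fun t => g t ord0 i)) ->
  measurable_fun D (euclid_norm \o g).
Proof.
move=> mg.
have msqrt : measurable_fun [set: R] (@Num.sqrt R).
  by apply: continuous_measurable_fun; exact: sqrt_continuous.
have ms : measurable_fun D (fun t => \sum_i g t ord0 i ^+ 2).
  by apply: measurable_sum => i; exact: measurable_funX.
exact: (measurableT_comp msqrt ms).
Qed.

End euclidean_norm.

Section bounded_functions.
Context d (T : measurableType d) (R : realType).
Variable mu : {measure set T -> \bar R}.

Lemma integral_bounded_lty (D : set T) (u : T -> R) (M : R) :
  measurable D -> (mu D < +oo)%E -> measurable_fun D u -> 0 <= M ->
  (forall x, D x -> `|u x| <= M) -> (\int[mu]_(x in D) `|u x|%:E < +oo)%E.
Proof.
move=> mD fD mu_ M0 uM.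
apply: (@le_lt_trans _ _ (\int[mu]_(x in D) M%:E)%E).
  apply: ge0_le_integral => //.
  by apply/measurable_EFinP; exact: measurableT_comp.
by rewrite integral_cst// lte_mul_pinfty// lee_fin.
Qed.

Lemma vmodular_bounded_lty (D : set T) (p u : T -> R) (P M : R) :
  measurable D -> (mu D < +oo)%E -> exponent D p -> measurable_fun D u ->
  (forall x, D x -> p x <= P) -> (forall x, D x -> `|u x| <= M) ->
  (vmodular mu D p u < +oo)%E.
Proof.
move=> mD fD ep mu_ pP uM.
have mup := (measurable_EFinP _ _).1 (measurable_vmodular mD ep mu_).
rewrite /vmodular (eq_integral (fun x => `| `|u x| `^ p x|%:E)); last first.
  by move=> x _; rewrite (ger0_norm (powR_ge0 _ _)).
(* The base is raised to at least [1] so that its power is monotone in the exponent, up to [P]. *)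
apply: (integral_bounded_lty (M := Num.max 1 M `^ P) mD fD mup (powR_ge0 _ _)) => x Dx.
have p0 : 0 <= p x by rewrite (le_trans _ (ep.2 _ Dx)).
rewrite (ger0_norm (powR_ge0 _ _)) (@le_trans _ _ (Num.max 1 M `^ p x))//.
  by apply: ge0_ler_powR; rewrite ?nnegrE// le_max ?ler01 ?(uM _ Dx) ?orbT.
by apply: ler_powR; [rewrite le_max lexx|exact: pP].
Qed.

End bounded_functions.

(** * Test functions as elements of the variable exponent Sobolev spaces *)

Section test_functions.
Context {R : realType} {N : nat}.
Notation V := 'rV[R]_N.+1.
Local Notation mu := (@lebesgue_rV R N).
Implicit Types (phi psi : V -> R) (i : 'I_N.+1) (x : V).
Variable Omega : set V.
Hypothesis Omega_open : open Omega.
Hypothesis Omega_bounded : bounded_set Omega.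

Let mOmega : measurable Omega. Proof. exact: open_measurable_rV. Qed.
Let fOmega : (mu Omega < +oo)%E. Proof. exact: lebesgue_rV_bounded. Qed.

Lemma smooth_continuous phi : smooth phi -> continuous phi.
Proof. by move=> /(_ 0%N)[]. Qed.

Lemma smooth_derivable phi i x : smooth phi -> derivable phi x (delta_mx ord0 i).
Proof. by move=> /(_ 1%N)[_ /(_ i)[]]. Qed.

Lemma smooth_partial_continuous phi i : smooth phi -> continuous (partial i phi).
Proof. by move=> /(_ 1%N)[_ /(_ i)[_ []]]. Qed.

Lemma Cc_smooth_eq0 phi x : Cc_smooth Omega phi -> ~ Omega x -> phi x = 0.
Proof.
move=> [_ _ sO] Ox; apply/eqP/negP => /negP p0; apply: Ox; apply: sO.
exact: subset_closure.
Qed.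

Lemma Cc_smooth_bounded phi : Cc_smooth Omega phi ->
  exists M : R, 0 <= M /\ forall x, `|phi x| <= M.
Proof.
move=> [sphi cK _]; apply: (compact_supp_bounded cK (smooth_continuous sphi)) => x Kx.
by apply/eqP/negP => /negP p0; apply: Kx; exact: subset_closure.
Qed.

Lemma Cc_smooth_partial_bounded phi i : Cc_smooth Omega phi ->
  exists M : R, 0 <= M /\ forall x, `|partial i phi x| <= M.
Proof.
move=> [sphi cK _].
apply: (compact_supp_bounded cK (smooth_partial_continuous sphi)) => x.
exact: partial_eq0.
Qed.

Lemma integrable_bounded_continuous (f : V -> R) (M : R) : continuous f ->
  (forall x, `|f x| <= M) -> (forall x, ~ Omega x -> f x = 0) ->
  mu.-integrable [set: V] (EFin \o f).
Proof.
move=> cf; exact: (integrable_bounded_supp mOmega fOmega (continuous_measurable_rV cf)).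
Qed.

Lemma integral_outside0 (f : V -> R) : (forall x, ~ Omega x -> f x = 0) ->
  (\int[mu]_(x in Omega) (f x)%:E = \int[mu]_x (f x)%:E)%E.
Proof.
move=> f0; rewrite integral_mkcond; apply: eq_integral => x _.
by rewrite patchE; case: ifPn => // /negP xO; rewrite f0// => Ox; apply: xO; rewrite inE.
Qed.

(** Product rule for [phi * psi], whose partial derivative has integral [0]. *)
Lemma integration_by_parts_Cc phi psi i :
  Cc_smooth Omega phi -> Cc_smooth Omega psi ->
  (\int[mu]_(x in Omega) (phi x * partial i psi x)%:E =
   - \int[mu]_(x in Omega) (partial i phi x * psi x)%:E)%E.
Proof.
move=> cphi cpsi; have [sphi Kphi _] := cphi; have [spsi Kpsi _] := cpsi.
have [M1 [M10 phiM]] := Cc_smooth_bounded cphi.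
have [M2 [M20 psiM]] := Cc_smooth_bounded cpsi.
have [M3 [M30 dphiM]] := Cc_smooth_partial_bounded i cphi.
have [M4 [M40 dpsiM]] := Cc_smooth_partial_bounded i cpsi.
have cphi' := smooth_continuous sphi; have cpsi' := smooth_continuous spsi.
have cdphi := @smooth_partial_continuous _ i sphi.
have cdpsi := @smooth_partial_continuous _ i spsi.
pose f : V -> R := phi * psi.
have dE x : partial i f x = phi x * partial i psi x + partial i phi x * psi x.
  rewrite /partial deriveM; [|exact: smooth_derivable..].
  by rewrite /GRing.scale/= [psi x * _]mulrC.
have dEf : partial i f = (fun x => phi x * partial i psi x + partial i phi x * psi x).
  by apply/funext.
have cu : continuous (fun x => phi x * partial i psi x).
  by move=> x; exact: (cvgM (cphi' x) (cdpsi x)).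
have cv : continuous (fun x => partial i phi x * psi x).
  by move=> x; exact: (cvgM (cdphi x) (cpsi' x)).
have cf : continuous f by move=> x; exact: (cvgM (cphi' x) (cpsi' x)).
have cKf : compact (closure [set x | f x != 0]).
  apply: subclosed_compact Kphi _; first exact: closed_closure.
  by apply: closureS => x /=; apply: contra_neq => p0; rewrite /f/= /GRing.mul/= p0 mul0r.
have cdf : continuous (partial i f).
  by rewrite dEf => x; exact: (cvgD (cu x) (cv x)).
have df x : derivable f x (delta_mx ord0 i).
  by apply: derivableM; exact: smooth_derivable.
have := integral_partial_eq0 cf cKf df cdf; rewrite dEf.
have u0 x : ~ Omega x -> phi x * partial i psi x = 0.
  by move=> Ox; rewrite (Cc_smooth_eq0 cphi Ox) mul0r.
have v0 x : ~ Omega x -> partial i phi x * psi x = 0.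
  by move=> Ox; rewrite (Cc_smooth_eq0 cpsi Ox) mulr0.
have uM x : `|phi x * partial i psi x| <= M1 * M4.
  by rewrite normrM ler_pM.
have vM x : `|partial i phi x * psi x| <= M3 * M2.
  by rewrite normrM ler_pM.
have intu := integrable_bounded_continuous cu uM u0.
have intv := integrable_bounded_continuous cv vM v0.
rewrite (integral_outside0 u0) (integral_outside0 v0).
under eq_integral do rewrite EFinD.
rewrite (integralD measurableT intu intv) => /eqP uv.
(* Finiteness permits moving a term to the other side in the extended reals. *)
have fv : (\int[mu]_x (partial i phi x * psi x)%:E)%E \is a fin_num.
  exact: integrable_fin_num.
have fu : (\int[mu]_x (phi x * partial i psi x)%:E)%E \is a fin_num.
  exact: integrable_fin_num.
move: uv; rewrite -(fineK fu) -(fineK fv) -EFinD eqe addr_eq0 => /eqP ->.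
by rewrite EFinN.
Qed.

Lemma in_Lpx_bounded p (f : V -> R) (M : R) : bounded_exponent Omega p ->
  measurable_fun Omega f -> 0 <= M -> (forall x, Omega x -> `|f x| <= M) ->
  in_Lpx Omega p f.
Proof.
move=> [mp p1 [P pP]] mf M0 fM; split; last first.
  exact: (vmodular_bounded_lty mOmega fOmega (conj mp p1) mf pP fM).
split=> // K KO cK; have mK : measurable K.
  rewrite -[K]setCK; apply: measurableC; apply: open_measurable_rV.
  by apply: closed_openC; apply: compact_closed => //; exact: norm_hausdorff.
apply: (integral_bounded_lty mK _ _ M0).
- exact: le_lt_trans (le_lebesgue_rV_outer KO) fOmega.
- exact: measurable_funS mOmega KO mf.
- by move=> x /KO; exact: fM.
Qed.

Lemma Cc_smooth_measurable phi : Cc_smooth Omega phi -> measurable_fun Omega phi.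
Proof.
move=> [sphi _ _].
exact: measurable_funTS (continuous_measurable_rV (smooth_continuous sphi)).
Qed.

Lemma gradientE phi i : (fun x => gradient phi x ord0 i) = partial i phi.
Proof. by apply/funext => x; rewrite mxE. Qed.

Lemma gradient_measurable phi i : Cc_smooth Omega phi ->
  measurable_fun Omega (fun x => gradient phi x ord0 i).
Proof.
move=> [sphi _ _]; rewrite gradientE.
exact: measurable_funTS (continuous_measurable_rV (smooth_partial_continuous sphi)).
Qed.

Lemma euclid_norm_gradient_bounded phi : Cc_smooth Omega phi ->
  exists M : R, 0 <= M /\ forall x, euclid_norm (gradient phi x) <= M.
Proof.
move=> cphi.
have /choice[M MP] := fun i => Cc_smooth_partial_bounded i cphi.
exists (Num.sqrt (\sum_i M i ^+ 2)); split=> [|x]; first exact: sqrtr_ge0.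
rewrite /euclid_norm ler_sqrt; last by apply: sumr_ge0 => i _; exact: sqr_ge0.
apply: ler_sum => i _; rewrite mxE -real_normK ?num_real//.
by rewrite ler_pXn2r// ?nnegrE ?(MP i).1// (MP i).2.
Qed.

Lemma Cc_smooth_in_W1px0 p phi : bounded_exponent Omega p ->
  Cc_smooth Omega phi -> in_W1px0 Omega p phi (gradient phi).
Proof.
move=> bp cphi; have [mp p1 _] := bp.
have [M [M0 phiM]] := Cc_smooth_bounded cphi.
have [M' [M'0 gphiM]] := euclid_norm_gradient_bounded cphi.
have Lphi : in_Lpx Omega p phi.
  by apply: (in_Lpx_bounded bp _ M0) => //; exact: Cc_smooth_measurable.
split.
  split; [|exact: Lphi|]; last first.
    apply: (in_Lpx_bounded bp _ M'0) => [|x _].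
      by apply: measurable_euclid_norm => i; exact: gradient_measurable.
    by rewrite ger0_norm ?euclid_norm_ge0//; exact: gphiM.
  split; first by have [] := Lphi.
    move=> i; have [D [D0 dphiM]] := Cc_smooth_partial_bounded i cphi.
    suff [] : in_Lpx Omega p (fun x => gradient phi x ord0 i) by [].
    apply: (in_Lpx_bounded bp _ D0) => [|x _]; first exact: gradient_measurable.
    by rewrite mxE; exact: dphiM.
  move=> psi cpsi i; rewrite (integration_by_parts_Cc i cphi cpsi).
  by congr (- _)%E; apply: eq_integral => x _; rewrite mxE.
(* A test function approximates itself with error [0]. *)
move=> e e0; exists phi => //; rewrite /W1px_norm.
have -> : Lpx_norm Omega p (phi \- phi) = 0%E.
  by apply: (vnorm0 mu (conj mp p1)) => x _ /=; rewrite subrr.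
have -> : Lpx_norm Omega p (euclid_norm \o (gradient phi \- gradient phi)) = 0%E.
  by apply: (vnorm0 mu (conj mp p1)) => x _ /=; rewrite subrr euclid_norm0.
by rewrite adde0 lte_fin.
Qed.

End test_functions.

(** * Continuity of the Sobolev constant *)

Section sobolev_constants.
Context {R : realType} {N : nat}.
Notation V := 'rV[R]_N.+1.
Local Notation mu := (@lebesgue_rV R N).
Variable Omega : set V.
Hypothesis Omega_open : open Omega.
Hypothesis Omega_bounded : bounded_set Omega.
Implicit Types (p q v : V -> R) (g : V -> V) (e s c : R).

Let mOmega : measurable Omega. Proof. exact: open_measurable_rV. Qed.
Let fOmega : (mu Omega < +oo)%E. Proof. exact: lebesgue_rV_bounded. Qed.
Let m := fine (mu Omega).
Let m0 : 0 <= m. Proof. by rewrite fine_ge0// measure_ge0. Qed.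

Let exponentW p : bounded_exponent Omega p -> exponent Omega p.
Proof. by case. Qed.

(** One-sided: the first argument is the smaller exponent. Hence perturbations enter as
    [exponent_close p p'] but [exponent_close q' q]. *)
Definition exponent_close p q e :=
  {ae mu, forall x, Omega x -> p x <= q x <= p x + e}.

Lemma in_Lpx_exponent p q e v : bounded_exponent Omega p ->
  bounded_exponent Omega q -> 0 <= e -> exponent_close p q e ->
  in_Lpx Omega q v -> in_Lpx Omega p v.
Proof.
move=> bp bq e0 pq [Lv fv]; split; [exact: Lv|].
exact: (vmodular_lty_exponent mOmega fOmega (exponentW bp) (exponentW bq) Lv.1 e0 pq fv).
Qed.

Lemma Lpx_norm_exponent p q e v : bounded_exponent Omega p ->
  bounded_exponent Omega q -> measurable_fun Omega v -> 0 <= e ->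
  exponent_close p q e ->
  (Lpx_norm Omega p v <= (1 + e * m)%:E * Lpx_norm Omega q v)%E.
Proof.
move=> bp bq mv e0 pq.
exact: (le_vnorm_exponent mOmega fOmega (exponentW bp) (exponentW bq) mv e0 pq).
Qed.

Lemma Lpx_norm_ge0 p v : (0 <= Lpx_norm Omega p v)%E.
Proof. exact: (vnorm_ge0 mu). Qed.

Lemma measurable_gradient_sub g phi :
  (forall i, L1loc Omega (fun x => g x ord0 i)) -> Cc_smooth Omega phi ->
  measurable_fun Omega (euclid_norm \o (g \- gradient phi)).
Proof.
move=> Lg cphi; apply: measurable_euclid_norm => i.
rewrite (_ : (fun t => _) = (fun t => g t ord0 i) \- (fun t => gradient phi t ord0 i)).
  by apply: measurable_funB; [exact: (Lg i).1|exact: gradient_measurable].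
by apply/funext => t; rewrite /= !mxE.
Qed.

(** The weak gradient condition does not involve the exponent, and the same test functions
    approximate: an error [r / (1 + e * m)] for [q] is an error [r] for [p]. *)
Lemma in_W1px0_exponent p q e v g : bounded_exponent Omega p ->
  bounded_exponent Omega q -> 0 <= e -> exponent_close p q e ->
  in_W1px0 Omega q v g -> in_W1px0 Omega p v g.
Proof.
move=> bp bq e0 pq [[wvg Lv Lg] dense]; split.
  split; [exact: wvg|exact: (in_Lpx_exponent bp bq e0 pq Lv)|].
  exact: (in_Lpx_exponent bp bq e0 pq Lg).
move=> r r0; have c0 : 0 < 1 + e * m by rewrite ltr_wpDr// mulr_ge0.
have [phi cphi W] := dense (r / (1 + e * m)) (divr_gt0 r0 c0).
exists phi; first exact: cphi.
have [[mv _] Lgi _] := wvg.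
have mvphi : measurable_fun Omega (v \- phi).
  by apply: measurable_funB mv (Cc_smooth_measurable cphi).
have mgphi := measurable_gradient_sub Lgi cphi.
apply: (@le_lt_trans _ _ ((1 + e * m)%:E *
    W1px_norm Omega q (v \- phi)%R (g \- gradient phi)%R)%E).
  rewrite ge0_muleDr ?Lpx_norm_ge0//.
  exact: (leeD (Lpx_norm_exponent bp bq mvphi e0 pq)
    (Lpx_norm_exponent bp bq mgphi e0 pq)).
by rewrite -lte_pdivlMl// -EFinM (mulrC _ r); exact: W.
Qed.

Lemma sobolev_quotient_ge0 p q v g : (0 <= sobolev_quotient Omega p q v g)%E.
Proof.
rewrite /sobolev_quotient; case: ifPn => // _.
by rewrite mule_ge0 ?inve_ge0 ?Lpx_norm_ge0.
Qed.

Lemma sobolev_quotient_lty p q v g : (Lpx_norm Omega q v < +oo)%E ->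
  sobolev_quotient Omega p q v g =
  (Lpx_norm Omega p (euclid_norm \o g) / Lpx_norm Omega q v)%E.
Proof. by rewrite ltey /sobolev_quotient => /negbTE ->. Qed.

Lemma sobolev_quotient_y p q v g : Lpx_norm Omega q v = +oo%E ->
  sobolev_quotient Omega p q v g = 0%E.
Proof. by rewrite /sobolev_quotient => ->; rewrite eqxx. Qed.

Lemma sobolev_constant_ge0 p q : (0 <= sobolev_constant Omega p q)%E.
Proof.
by apply: le_ereal_inf_tmp => _ [v [g [_ _ ->]]]; exact: sobolev_quotient_ge0.
Qed.

Lemma lee_div_pmul (a a' b b' : \bar R) (k : R) : 0 < k ->
  (0 <= a)%E -> (0 <= a')%E -> (0 <= b)%E -> (0 <= b')%E -> (b < +oo)%E ->
  (a <= k%:E * a')%E -> (b' <= k%:E * b)%E ->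
  (a / b <= (k ^+ 2)%:E * (a' / b'))%E.
Proof.
move=> k0 a0 a'0 b0 b'0 boo aa' bb'.
have bb : (b^-1 <= k%:E * b'^-1)%E.
  (* The reciprocal of [0] is [+oo], so the bound is trivial here. *)
  have [b'z|b'n] := eqVneq b' 0%E; first by rewrite b'z inve0 gt0_muley ?lte_fin// leey.
  have b'f : b' \is a fin_num.
    by rewrite ge0_fin_numE// (le_lt_trans bb')// lte_mul_pinfty// ?lee_fin ltW.
  have bf : b \is a fin_num by rewrite ge0_fin_numE.
  move: b'n bb' b'0 b0; rewrite -(fineK b'f) -(fineK bf).
  move: (fine b') (fine b) => s' s.
  rewrite eqe -EFinM !lee_fin => s'n ss s'0 s0.
  have s'p : 0 < s' by rewrite lt_neqAle eq_sym s'n.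
  have sp : 0 < s by rewrite -(pmulr_rgt0 _ k0) (lt_le_trans s'p).
  by rewrite !inver !gt_eqF// -EFinM lee_fin ler_pdivlMr// mulrC ler_pdivrMr.
rewrite expr2 EFinM muleACA; apply: lee_pmul => //.
by rewrite inve_ge0.
Qed.

Lemma sobolev_constant_le p q p' q' e : bounded_exponent Omega p ->
  bounded_exponent Omega q -> bounded_exponent Omega p' ->
  bounded_exponent Omega q' -> 0 <= e ->
  exponent_close p p' e -> exponent_close q' q e ->
  (sobolev_constant Omega p q <=
   ((1 + e * m) ^+ 2)%:E * sobolev_constant Omega p' q')%E.
Proof.
move=> bp bq bp' bq' e0 pp' q'q.
have c0 : 0 < 1 + e * m by rewrite ltr_wpDr// mulr_ge0.
rewrite -lee_pdivrMl ?exprn_gt0//.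
apply: le_ereal_inf_tmp => _ [v [g [Wvg vn0 ->]]].
rewrite lee_pdivrMl ?exprn_gt0//.
apply: (@le_trans _ _ (sobolev_quotient Omega p q v g)).
  apply: ereal_inf_lbound; exists v, g; split; [|exact: vn0|by []].
  exact: (in_W1px0_exponent bp bp' e0 pp' Wvg).
have [[[[mv _] Lgi _] _ [[mg _] _]] _] := Wvg.
(* An infinite [q]-norm makes the left quotient [0] by convention; otherwise the [q']-norm is finite
   too and both quotients are genuine. *)
have [qoo|] := eqVneq (Lpx_norm Omega q v) +oo%E.
  rewrite (sobolev_quotient_y _ _ qoo) mule_ge0 ?sobolev_quotient_ge0//.
  by rewrite lee_fin exprn_ge0// ltW.
rewrite -ltey => qoo.
have q'v := Lpx_norm_exponent bq' bq mv e0 q'q.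
have q'oo : (Lpx_norm Omega q' v < +oo)%E.
  by apply: (le_lt_trans q'v); rewrite lte_mul_pinfty// lee_fin ltW.
rewrite (sobolev_quotient_lty _ _ qoo) (sobolev_quotient_lty _ _ q'oo).
exact: (lee_div_pmul c0 (Lpx_norm_ge0 _ _) (Lpx_norm_ge0 _ _) (Lpx_norm_ge0 _ _)
  (Lpx_norm_ge0 _ _) qoo (Lpx_norm_exponent bp bp' mg e0 pp') q'v).
Qed.

(** Turns a strict bound on a quotient into separate bounds with room on both sides; the conditional
    mirrors the convention in [sobolev_quotient]. *)
Lemma lt_div_between (a b : \bar R) s : (0 <= a)%E -> (a < +oo)%E -> (0 < b)%E ->
  ((if b == +oo then 0 else a / b) < s%:E)%E ->
  exists c a', [/\ 0 < c, (c%:E < b)%E, (a < a'%:E)%E & a' < s * c].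
Proof.
move=> a0 aoo b0; have af : a \is a fin_num by rewrite ge0_fin_numE.
rewrite -(fineK af) lee_fin in a0 *; move: (fine a) a0 => {aoo af}a a0.
case: ifPn => [/eqP -> |].
  (* An infinite denominator exceeds every [c]; this one makes [s * c = a + 2]. *)
  rewrite lte_fin => s0; exists ((a + 2) / s), (a + 1); split.
  - by rewrite divr_gt0// ltr_wpDl.
  - by rewrite ltry.
  - by rewrite lte_fin ltrDl.
  - by rewrite mulrC divfK ?gt_eqF// ltrD2l ltr1n.
move: b0; case: b => [b| |]//; rewrite lte_fin => b0 _.
rewrite inver gt_eqF// -EFinM lte_fin ltr_pdivrMr// => asb.
have s0 : 0 < s by rewrite -(pmulr_lgt0 _ b0) (le_lt_trans a0).
have asb' : a / s < b by rewrite ltr_pdivrMr// mulrC.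
(* Strictly between [a / s] and [b], hence [a < s * c]; [a'] is then the midpoint of [a] and
   [s * c]. *)
pose c := (a / s + b) / 2.
have asc : a < s * c by rewrite mulrC -ltr_pdivrMr// /c; lra.
exists c, ((a + s * c) / 2); split; rewrite ?lte_fin.
- by rewrite divr_gt0// ltr_wpDl// divr_ge0// ltW.
- by rewrite /c ltr_pdivrMr//; lra.
- by rewrite ltr_pdivlMr//; lra.
- by rewrite ltr_pdivrMr//; lra.
Qed.

Lemma div_le_of_le (a b : \bar R) s c : 0 < c -> 0 <= s ->
  (a <= (s * c)%:E)%E -> (c%:E <= b)%E -> (b < +oo)%E -> (a / b <= s%:E)%E.
Proof.
move=> c0 s0 asc; case: b => [b| |]//; rewrite lee_fin => cb _.
have b0 : 0 < b by rewrite (lt_le_trans c0).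
rewrite inver gt_eqF// lee_pdivrMr//; apply: (le_trans asc).
by rewrite -EFinM lee_fin ler_wpM2l.
Qed.

(** Numerator and denominator are bounded separately through [c], so that each can be perturbed on
    its own later. *)
Lemma Cc_smooth_near_optimal p q s : bounded_exponent Omega p ->
  bounded_exponent Omega q -> (sobolev_constant Omega p q < s%:E)%E ->
  exists phi c, [/\ Cc_smooth Omega phi, 0 < c, (c%:E < Lpx_norm Omega q phi)%E &
    (Lpx_norm Omega p (euclid_norm \o gradient phi) < (s * c)%:E)%E].
Proof.
move=> bp bq /ereal_inf_lt[_ [v [g [[[[[mv _] Lgi _] Lv [[mg _] fg]] dense] vn0 ->]]]].
have ep := exponentW bp; have eq := exponentW bq.
rewrite /sobolev_quotient.
set a := Lpx_norm Omega p (euclid_norm \o g); set b := Lpx_norm Omega q v => Q.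
have b0 : (0 < b)%E.
  rewrite lt_neqAle Lpx_norm_ge0 andbT; apply/eqP => b0; apply: vn0.
  exact: (vnorm_eq0_ae mOmega fOmega eq mv (esym b0)).
have aoo : (a < +oo)%E := vnorm_lty mOmega fOmega ep mg fg.
have a0 : (0 <= a)%E := Lpx_norm_ge0 p _.
have [c [a1 [c0 cb aa1 a1sc]]] := lt_div_between a0 aoo b0 Q.
(* The first term keeps the gradient norms below [s * c]; the second is the rate required by
   [ae_cvg_of_vnorm]. *)
pose d (n : nat) := Num.min (s * c - a1) (2 ^ n.+1)%:R^-1.
have d0 n : 0 < d n.
  by rewrite lt_min invr_gt0 ltr0n expn_gt0/= andbT subr_gt0.
have /choice[phi phiP] : forall n, exists phi, Cc_smooth Omega phi /\
    (W1px_norm Omega p (v \- phi)%R (g \- gradient phi)%R < (d n)%:E)%E.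
  move=> n; have [phi cphi W] := dense _ (d0 n).
  by exists phi; split; [exact: cphi|exact: W].
have normlt n : (Lpx_norm Omega p (euclid_norm \o gradient (phi n)) < (s * c)%:E)%E.
  have [cphi W] := phiP n.
  have mgphi := measurable_gradient_sub Lgi cphi.
  have mgr : measurable_fun Omega (euclid_norm \o gradient (phi n)).
    by apply: measurable_euclid_norm => i; exact: gradient_measurable.
  rewrite (_ : s * c = a1 + (s * c - a1)); last by lra.
  have gg x : Omega x -> `|(euclid_norm \o gradient (phi n)) x| <=
      `|(euclid_norm \o g) x| + `|(euclid_norm \o (g \- gradient (phi n))) x|.
    move=> _ /=; rewrite !ger0_norm ?euclid_norm_ge0//.
    apply: le_trans (le_euclid_normB _ _).
    by rewrite opprB addrC subrK.
  apply: (vnorm_ltD mOmega ep mg mgphi mgr gg aa1).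
  apply: le_lt_trans (lt_le_trans W _); last by rewrite lee_fin ge_min lexx.
  by apply: leeDr; exact: Lpx_norm_ge0.
have [[n cn]|] := pselect (exists n, (c%:E < Lpx_norm Omega q (phi n))%E).
  by exists (phi n), c; split; [exact: (phiP n).1|exact: c0|exact: cn|exact: normlt].
(* If no approximant had [q]-norm above [c], Fatou's lemma would give [|v|_q <= c], against the
   choice of [c]. *)
move=> /forallNP nc; exfalso; move: cb; rewrite ltNge => /negP; apply.
have mphi n := Cc_smooth_measurable (phiP n).1.
apply: (vnorm_fatou mOmega fOmega eq mv mphi _ (ltW c0)); last first.
  by move=> n; rewrite leNgt; apply/negP; exact: nc.
apply: (ae_cvg_of_vnorm mOmega fOmega ep mv mphi) => n.
apply: (le_lt_trans _ (lt_le_trans (phiP n).2 _)).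
  by apply: leeDl; exact: Lpx_norm_ge0.
by rewrite lee_fin ge_min lexx orbT.
Qed.

(** The test function is fixed before the new exponents, so the threshold on [e] is independent of
    [p'] and [q']. *)
Lemma sobolev_constant_near_le p q s : bounded_exponent Omega p ->
  bounded_exponent Omega q -> (sobolev_constant Omega p q < s%:E)%E ->
  \forall e \near 0^'+, forall p' q', bounded_exponent Omega p' ->
    bounded_exponent Omega q' -> exponent_close p p' e ->
    exponent_close q' q e -> (sobolev_constant Omega p' q' <= s%:E)%E.
Proof.
move=> bp bq /(Cc_smooth_near_optimal bp bq)[phi [c [cphi c0 cq ps]]].
have ep := exponentW bp; have eq := exponentW bq.
have [M [M0 phiM]] := Cc_smooth_bounded cphi.
have [M' [M'0 gphiM]] := euclid_norm_gradient_bounded cphi.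
have mphi := Cc_smooth_measurable cphi.
have mgr : measurable_fun Omega (euclid_norm \o gradient phi).
  by apply: measurable_euclid_norm => i; exact: gradient_measurable.
have [l [l0 lsc hl]] := vnorm_lt ps.
(* Levels [c < c1 < c2] below [|phi|_q] leave the factor [c2 / c1 > 1] to absorb [T ^ e]. *)
have [c2 [cc2 c2q]] : exists c2, c < c2 /\ (c2%:E < Lpx_norm Omega q phi)%E.
  have : (0 <= Lpx_norm Omega q phi)%E := Lpx_norm_ge0 q phi.
  move: cq; case: (Lpx_norm Omega q phi) => [r| |]// cq _.
    by rewrite lte_fin in cq; exists ((c + r) / 2); rewrite lte_fin; split; lra.
  by exists (c + 1); rewrite ltrDl ltr01 ltry.
pose c1 := (c + c2) / 2.
have cc1 : c < c1 by rewrite /c1; lra.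
have c1c2 : c1 < c2 by rewrite /c1; lra.
have c10 : 0 < c1 by exact: lt_trans cc1.
(* A common bound, at least [1], for the gradient at scale [l] and for [phi] at scale [c1]. *)
pose T := 1 + M' / l + M / c1.
have Ml0 : 0 <= M' / l by rewrite divr_ge0// ltW.
have Mc0 : 0 <= M / c1 by rewrite divr_ge0// ltW.
have T1 : 1 <= T by rewrite /T; lra.
rewrite lte_fin in lsc.
near=> e => p' q' bp' bq' pp' q'q.
have ep' := exponentW bp'; have eq' := exponentW bq'.
have e0 : 0 <= e by apply: ltW; near: e; exact: nbhs_right_gt.
have Tl : T `^ e < s * c / l.
  by near: e; apply: powR_lt_near0 => //; rewrite ltr_pdivlMr// mul1r.
have Tc : T `^ e < c2 / c1.
  by near: e; apply: powR_lt_near0 => //; rewrite ltr_pdivlMr// mul1r.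
have normp' : (Lpx_norm Omega p' (euclid_norm \o gradient phi) <= (s * c)%:E)%E.
  apply: (@le_trans _ _ (T `^ e * l)%:E); last by rewrite lee_fin -ler_pdivlMr// ltW.
  apply: (vnorm_le_bounded mOmega fOmega ep ep' mgr l0 T1 _ pp' hl e0) => x _ /=.
  rewrite ger0_norm ?euclid_norm_ge0//.
  apply: (@le_trans _ _ (M' / l)); last by rewrite /T; lra.
  by rewrite ler_pM2r ?invr_gt0.
(* Otherwise [c1] would be an admissible scale for [q'], and raising the exponent to [q] would give
   [|phi|_q <= T ^ e * c1 < c2]. *)
have normq' : (c%:E <= Lpx_norm Omega q' phi)%E.
  rewrite leNgt; apply/negP => qc.
  have h1 : (vmodular mu Omega q' (fun x => (phi x / c1)%R) <= 1)%E.
    apply: (vnorm_lt_vmodular mOmega fOmega eq' mphi _).2.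
    by apply: lt_trans qc _; rewrite lte_fin.
  have : (Lpx_norm Omega q phi <= (T `^ e * c1)%:E)%E.
    apply: (vnorm_le_bounded mOmega fOmega eq' eq mphi c10 T1 _ q'q h1 e0) => x _ /=.
    rewrite (@le_trans _ _ (M / c1))//; last by rewrite /T; lra.
    by rewrite ler_pM2r ?invr_gt0.
  apply/negP; rewrite -ltNge; apply: lt_trans c2q.
  by rewrite lte_fin -ltr_pdivlMr.
apply: (@le_trans _ _ (sobolev_quotient Omega p' q' phi (gradient phi))).
  apply: ereal_inf_lbound; exists phi, (gradient phi); split; [| |by []].
    exact: Cc_smooth_in_W1px0.
  move=> phi0; move: cq; rewrite (_ : Lpx_norm Omega q phi = 0%E).
    by rewrite lte_fin ltNge (ltW c0).
  exact: (vnorm_ae0 mOmega fOmega eq mphi phi0).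
have sc0 : 0 < s * c by exact: (lt_trans l0 lsc).
have s0 : 0 < s by rewrite -(pmulr_lgt0 _ c0).
have [qoo|] := eqVneq (Lpx_norm Omega q' phi) +oo%E.
  by rewrite (sobolev_quotient_y _ _ qoo) lee_fin ltW.
rewrite -ltey => qoo; rewrite (sobolev_quotient_lty _ _ qoo).
exact: (div_le_of_le c0 (ltW s0) normp' normq' qoo).
Unshelve. all: by end_near. Qed.

Lemma Linfty_norm_lt_ae (u : V -> R) e :
  (Linfty_norm Omega u < e%:E)%E -> {ae mu, forall x, Omega x -> `|u x| <= e}.
Proof.
rewrite /Linfty_norm unlock; case: ifPn => [_ ue|].
  have : (ess_sup mu (abse \o (EFin \o u \_ Omega)) <= e%:E)%E by exact: ltW.
  move=> /ess_supP; apply: filterS => x /= + Ox.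
  by rewrite patchE mem_set.
(* On a space of measure zero the norm is [0] by convention, but every set is negligible. *)
rewrite -leNgt => muT _; exists setT; split => //.
by apply/eqP; rewrite eq_le muT measure_ge0.
Qed.

End sobolev_constants.

Lemma ereal_squeeze_sqr (R : realType) (u : (\bar R)^nat) (l : \bar R) (k : R) :
  (0 <= l)%E -> (forall n, (0 <= u n)%E) -> 0 <= k ->
  (forall s : R, (l < s%:E)%E -> \forall n \near \oo, (u n <= s%:E)%E) ->
  (forall e : R, 0 < e ->
    \forall n \near \oo, (l <= ((1 + e * k) ^+ 2)%:E * u n)%E) ->
  u n @[n --> \oo] --> l.
Proof.
move=> l0 u0 k0 ul lu.
(* The limit [+oo] does occur, for instance for empty [Omega]; the lower estimate with a fixed
   factor then forces [u n = +oo] eventually. *)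
case: l l0 ul lu => [r| |]// r0 ul lu; last first.
  suff E : {near \oo, cst +oo%E =1 u} by exact: cvg_trans (near_eq_cvg E) (cvg_cst _).
  have := lu 1 ltr01; apply: filterS => n /=; have := u0 n.
  by case: (u n) => // x _; rewrite -EFinM leye_eq.
have fu : \forall n \near \oo, u n \is a fin_num.
  have : (r%:E < (r + 1)%:E)%E by rewrite lte_fin ltrDl.
  move=> /ul; apply: filterS => n un.
  by rewrite ge0_fin_numE// (le_lt_trans un) ?ltry.
apply/fine_cvgP; split=> //; apply/cvgrPdist_le => e e0.
(* Such a [d] exists since [(1 + d * k) ^ 2] tends to [1]; with it, [u n < r - e] contradicts the
   lower estimate. *)
have [d d0 dr] : exists2 d, 0 < d & (1 + d * k) ^+ 2 * (r - e) < r.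
  have : (1 + d * k) ^+ 2 * (r - e) @[d --> (0 : R)] --> (1 + 0 * k) ^+ 2 * (r - e).
    apply: cvgM; last exact: cvg_cst.
    rewrite expr2; under eq_fun do rewrite expr2.
    have cvg_factor : 1 + d * k @[d --> (0 : R)] --> 1 + 0 * k.
      by apply: cvgD; [exact: cvg_cst|apply: cvgM; [exact: cvg_id|exact: cvg_cst]].
    exact: (cvgM cvg_factor cvg_factor).
  rewrite mul0r addr0 expr1n mul1r => h.
  have rer : r - e < r by rewrite ltrBlDr ltrDl.
  have : \forall d \near (0 : R), (1 + d * k) ^+ 2 * (r - e) < r.
    by apply: cvgr_lt h _ rer.
  move=> /nbhs_ballP[d /= d0 hd]; exists (d / 2); first by rewrite divr_gt0.
  apply: hd; rewrite /ball/= sub0r normrN gtr0_norm ?divr_gt0//.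
  by rewrite ltr_pdivrMr// ltr_pMr// ltr1n.
have re : (r%:E < (r + e)%:E)%E by rewrite lte_fin ltrDl.
near=> n.
have un : u n \is a fin_num by near: n.
have h1 : (u n <= (r + e)%:E)%E by near: n; exact: ul.
have h2 : (r%:E <= ((1 + d * k) ^+ 2)%:E * u n)%E by near: n; exact: lu.
move: h1 h2; rewrite -(fineK un) -EFinM !lee_fin => h1 h2.
rewrite distrC ler_distl h1 andbT leNgt; apply/negP => h3.
have : (1 + d * k) ^+ 2 * fine (u n) <= (1 + d * k) ^+ 2 * (r - e).
  by rewrite ler_wpM2l ?sqr_ge0// ltW.
by move=> /(le_trans h2)/le_lt_trans/(_ dr); rewrite ltxx.
Unshelve. all: by end_near. Qed.

Theorem theorem5p2 (R : realType) (N : nat) (Omega : set 'rV[R]_N.+1)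
  (p q : 'rV[R]_N.+1 -> R) (pn qn : nat -> 'rV[R]_N.+1 -> R)
  (Omega_open : open Omega) (Omega_bounded : bounded_set Omega)
  (hp : bounded_exponent Omega p) (hq : bounded_exponent Omega q)
  (hpn : forall n, bounded_exponent Omega (pn n))
  (hqn : forall n, bounded_exponent Omega (qn n))
  (pn_cvg : Linfty_norm Omega (fun x => pn n x - p x) @[n --> \oo] --> 0%E)
  (qn_cvg : Linfty_norm Omega (fun x => qn n x - q x) @[n --> \oo] --> 0%E)
  (pn_ge : forall n, {ae lebesgue_rV, forall x, Omega x -> p x <= pn n x})
  (qn_le : forall n, {ae lebesgue_rV, forall x, Omega x -> qn n x <= q x}) :
  sobolev_constant Omega (pn n) (qn n) @[n --> \oo]
    --> sobolev_constant Omega p q.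
Proof.
(* Monotonicity gives the lower half of [exponent_close], uniform convergence the upper half. *)
have pn_near e : 0 < e -> \forall n \near \oo, exponent_close Omega p (pn n) e.
  move=> e0; have : \forall n \near \oo,
      (Linfty_norm Omega (fun x => (pn n x - p x)%R) < e%:E)%E.
    exact: pn_cvg _ (open_ereal_lt' (_ : 0 < e%:E)%E).
  apply: filterS => n /Linfty_norm_lt_ae; move: (pn_ge n).
  apply: filterS2 => x + + Ox => /(_ Ox) ppn /(_ Ox); rewrite ler_distl => /andP[_ h].
  by rewrite ppn.
have qn_near e : 0 < e -> \forall n \near \oo, exponent_close Omega (qn n) q e.
  move=> e0; have : \forall n \near \oo,
      (Linfty_norm Omega (fun x => (qn n x - q x)%R) < e%:E)%E.
    exact: qn_cvg _ (open_ereal_lt' (_ : 0 < e%:E)%E).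
  apply: filterS => n /Linfty_norm_lt_ae; move: (qn_le n).
  apply: filterS2 => x + + Ox => /(_ Ox) qqn /(_ Ox); rewrite ler_distlC => /andP[_ h].
  by rewrite qqn.
apply: (@ereal_squeeze_sqr R _ _ (fine (lebesgue_rV Omega))).
- exact: sobolev_constant_ge0.
- by move=> n; exact: sobolev_constant_ge0.
- by rewrite fine_ge0// measure_ge0.
- move=> s /(sobolev_constant_near_le Omega_open Omega_bounded hp hq) sn.
  (* One admissible [e] is fixed before [n] is taken large. *)
  have [e [e0 se]] : exists e, 0 < e /\ forall p' q', bounded_exponent Omega p' ->
      bounded_exponent Omega q' -> exponent_close Omega p p' e ->
      exponent_close Omega q' q e -> (sobolev_constant Omega p' q' <= s%:E)%E.
    near (0 : R)^'+ => e; exists e; split; first by near: e; exact: nbhs_right_gt.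
    by near: e.
  by apply: filterS2 (pn_near _ e0) (qn_near _ e0) => n; exact: se.
- move=> e e0; apply: filterS2 (pn_near _ e0) (qn_near _ e0) => n pe qe.
  exact: (sobolev_constant_le Omega_open Omega_bounded hp hq (hpn n) (hqn n)
    (ltW e0) pe qe).
Unshelve. all: by end_near. Qed.
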